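(* Let $n\ge2$ be an integer and let $F\in M_n(\mathbb{C})$ be a matrix such that $F\overline{F}=c\mathds{1}$ for some $c\in\mathbb{R}\setminus\{0\}$. Let $M:=L^\infty(O_F^+)$ and let $N$ be the even von Neumann subalgebra of $M$. Then the inclusion $N\subseteq M$ is strongly of finite index. Moreover, one can find an orthonormal basis of the right $N$-module $L^2(M)_N$ consisting of at most $n^2+1$ elements.
   Context: $\mathrm{Pol}(O_F^+)$ is the universal unital $*$-algebra generated by the entries $u_{ij}$ ($1\le i,j\le n$) of a unitary matrix $U$ subject to $U=F\overline{U}F^{-1}$, where $(\overline{U})_{ij}=u_{ij}^*$. With the comultiplication determined by $\Delta(u_{ij})=\sum_{k=1}^nu_{ik}\otimes u_{kj}$ it is a Hopf $*$-algebra, which defines a compact quantum group $O_F^+$ (free orthogonal quantum group). It has a Haar state $h$, and $L^\infty(O_F^+)$ is the von Neumann algebra generated by $\mathrm{Pol}(O_F^+)$ in the GNS representation of $h$; $h$ extends to a faithful normal state on it. The even subalgebra $N$ of $M=L^\infty(O_F^+)$ is the von Neumann subalgebra generated by the elements $u_{ij}u_{kl}$, $1\le i,j,k,l\le n$. The conditional expectation used is the faithful normal $h$-preserving conditional expectation $\mathbb{E}_N:M\to N$, and $L^2(M)=L^2(M,h)$. Let $N\subseteq M$ be an inclusion of von Neumann algebras with a faithful normal conditional expectation $\mathbb{E}_N:M\to N$. A family $(m_i)_{i\in I}$ of elements of $M$ is an orthonormal basis of the right $N$-module $L^2(M)_N$ if (1) for all $i,j\in I$, $\mathbb{E}_N(m_i^*m_j)=\delta_{ij}p_j$,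 where $p_j$ is a projection in $N$; and (2) $\overline{\sum_{i\in I}m_iN}=L^2(M)$ (with $M$ viewed inside $L^2(M)$). The inclusion $N\subseteq M$ is strongly of finite index if it admits a finite orthonormal basis. *)

(* Defs.v *)
From HB Require Import structures.
From mathcomp Require Import all_boot all_order all_algebra.
From mathcomp Require Import sesquilinear.
From mathcomp Require Import all_classical all_reals all_analysis.
From mathcomp Require Import complex.

Set Implicit Arguments.
Unset Strict Implicit.
Unset Printing Implicit Defensive.

Import Order.TTheory GRing.Theory Num.Theory.
Import numFieldNormedType.Exports.

Local Open Scope classical_set_scope.
Local Open Scope ring_scope.
Local Open Scope complex_scope.

(* [algType] requires 1 != 0.  This is harmless below: a map into the zero
   algebra exists and is unique, so the zero algebra contributes nothing to
   the universal property in [free_orthogonal]. *)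
HB.mixin Record hasStar (C : numClosedFieldType) A of GRing.Algebra C A := {
  star : A -> A ;
  starK : involutive star ;
  starD : {morph star : a b / a + b} ;
  starM : forall a b, star (a * b) = star b * star a ;
  starZ : forall (k : C) a, star (k *: a) = k^* *: star a
}.

#[short(type="starAlgType")]
HB.structure Definition StarAlgebra (C : numClosedFieldType) :=
  {A of GRing.Algebra C A & hasStar C A}.

Section StarAlgebras.
Variable C : numClosedFieldType.
Implicit Types A B T : starAlgType C.

Definition star_morphism A B (f : A -> B) : Prop :=
  forall a, f (star a) = star (f a).

Definition unitary_matrix A n (U : 'M[A]_n) : Prop :=
  let Uadj := map_mx star U^T in U *m Uadj = 1%:M /\ Uadj *m U = 1%:M.

Definition free_orthogonal_relations n (F : 'M[C]_n) A (U : 'M[A]_n) : Prop :=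
  let scal (G : 'M[C]_n) : 'M[A]_n := map_mx (in_alg A) G in
  unitary_matrix U /\ U = scal F *m map_mx star U *m scal (invmx F).

(* [A], with generators the entries of [U], is Pol(O_F^+). *)
Definition free_orthogonal n (F : 'M[C]_n) A (U : 'M[A]_n) : Prop :=
  [/\ free_orthogonal_relations F U,
      forall B (V : 'M[B]_n), free_orthogonal_relations F V ->
        exists2 f : {lrmorphism A -> B}, star_morphism f & map_mx f U = V &
      forall B (f g : {lrmorphism A -> B}),
        star_morphism f -> star_morphism g ->
        map_mx f U = map_mx g U -> f =1 g].

(* [T] is the algebraic tensor product of [A] and [B], with its usual
   *-algebra structure; [t a b] is the elementary tensor. *)
Definition tensor_product A B T (t : {bilinear A -> B -> T}) : Prop :=
  [/\ forall (V : lmodType C) (b : {bilinear A -> B -> V}),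
        exists f : {linear T -> V}, forall x y, f (t x y) = b x y,
      forall (V : lmodType C) (f g : {linear T -> V}),
        (forall x y, f (t x y) = g (t x y)) -> f =1 g,
      t 1 1 = 1,
      forall x x' y y', t x y * t x' y' = t (x * x') (y * y') &
      forall x y, star (t x y) = t (star x) (star y)].

Definition comultiplication n A (U : 'M[A]_n) T (t : A -> A -> T)
    (Delta : {lrmorphism A -> T}) : Prop :=
  star_morphism Delta /\
  forall i j, Delta (U i j) = \sum_(k < n) t (U i k) (U k j).

Definition state A (h : {scalar A}) : Prop :=
  h 1 = 1 /\ forall a, 0 <= h (star a * a).

(* (h (x) id) Delta(a) = h(a) 1 = (id (x) h) Delta(a); the slice maps are the
   linear maps determined by their values on elementary tensors. *)
Definition haar_state A T (t : A -> A -> T) (Delta : A -> T)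
    (h : {scalar A}) : Prop :=
  [/\ state h,
      forall s : {linear T -> A}, (forall x y, s (t x y) = h x *: y) ->
        forall a, s (Delta a) = h a *: 1 &
      forall s : {linear T -> A}, (forall x y, s (t x y) = h y *: x) ->
        forall a, s (Delta a) = h a *: 1].

End StarAlgebras.

(* The inner product is linear in its first argument. *)
Record hilbertSpace (R : realType) := HilbertSpace {
  hilbert_sort :> completeNormedModType R[i] ;
  inner : {dot hilbert_sort for @Num.conj R[i]} ;
  hilbert_normE : forall x : hilbert_sort, `|x| ^+ 2 = inner x x
}.

Section Operators.
Variables (R : realType) (H : hilbertSpace R).
Local Notation C := R[i].
Local Notation "'[ x , y ]" := (inner H x y).
Implicit Types (S T x y p : H -> H) (V M N : set (H -> H)).

Definition bounded_operator T : Prop := linear T /\ continuous T.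

Definition adjoint T : H -> H :=
  xget 0 [set S | bounded_operator S /\ forall v w, '[T v, w] = '[v, S w]].

Definition projection p : Prop :=
  [/\ bounded_operator p, p \o p = p & adjoint p = p].

Definition positive_operator T : Prop := forall v, 0 <= '[T v, v].

Definition operator_le S T : Prop := positive_operator (T - S).

Definition commutant V : set (H -> H) :=
  [set T | bounded_operator T /\ forall S, V S -> S \o T = T \o S].

Definition von_neumann_algebra V : Prop :=
  [/\ V `<=` bounded_operator,
      forall T, V T -> V (adjoint T) &
      commutant (commutant V) = V].

Definition von_neumann_generated V : set (H -> H) :=
  smallest von_neumann_algebra V.

(* A map between von Neumann algebras is encoded as a function on all of
   [H -> H], of which only the values on [M] matter. *)
Definition conditional_expectation M N (E : (H -> H) -> H -> H) : Prop :=
  [/\ forall x, M x -> N (E x),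
      forall (k : C) x y, M x -> M y -> E (k *: x + y) = k *: E x + E y,
      forall x, M x -> positive_operator x -> positive_operator (E x),
      forall x, N x -> E x = x &
      forall a b x, N a -> N b -> M x -> E (a \o x \o b) = a \o E x \o b].

Definition faithful_on M (E : (H -> H) -> H -> H) : Prop :=
  forall x, M x -> positive_operator x -> E x = 0 -> x = 0.

Definition directed_positive (D : set (H -> H)) : Prop :=
  [/\ D !=set0, D `<=` positive_operator &
      forall x y, D x -> D y ->
        exists z, [/\ D z, operator_le x z & operator_le y z]].

Definition supremum_in M (D : set (H -> H)) x : Prop :=
  [/\ M x, forall y, D y -> operator_le y x &
      forall z, M z -> (forall y, D y -> operator_le y z) -> operator_le x z].

(* Increasing nets of positive elements are encoded by their (directed) ranges. *)
Definition normal_on M N (E : (H -> H) -> H -> H) : Prop :=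
  forall (D : set (H -> H)) x, D `<=` M -> directed_positive D ->
    supremum_in M D x -> supremum_in N (E @` D) (E x).

Definition vector_state (xi : H) x : C := '[x xi, xi].

Definition state_preserving_expectation M N (phi : (H -> H) -> C)
    (E : (H -> H) -> H -> H) : Prop :=
  [/\ conditional_expectation M N E, faithful_on M E, normal_on M N E &
      forall x, M x -> phi (E x) = phi x].

(* [H] with the cyclic vector [xi] is L^2(M), an element [x] of [M] being
   viewed in it as [x xi]. *)
Definition orthonormal_basis M N (xi : H) (E : (H -> H) -> H -> H)
    (I : eqType) (m : I -> H -> H) : Prop :=
  [/\ forall i, M (m i),
      exists2 p : I -> H -> H, (forall j, N (p j) /\ projection (p j)) &
        forall i j, E (adjoint (m i) \o m j) = if i == j then p j else 0 &
      closure [set v | exists k (f : 'I_k -> I) (x : 'I_k -> H -> H),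
                 (forall l, N (x l)) /\ v = \sum_(l < k) m (f l) (x l xi)]
      = [set: H]].

Definition strongly_finite_index M N (xi : H) (E : (H -> H) -> H -> H) : Prop :=
  exists (I : finType) (m : I -> H -> H), orthonormal_basis M N xi E m.

End Operators.

Section Linfty.
Variables (R : realType) (A : starAlgType R[i]) (H : hilbertSpace R).

Record gns_representation (h : A -> R[i]) (pi : A -> H -> H) (xi : H) : Prop := {
  gns_bounded : forall a, bounded_operator (pi a) ;
  gns_linear : linear pi ;
  gns_one : pi 1 = id ;
  gns_mul : forall a b, pi (a * b) = pi a \o pi b ;
  gns_star : forall a, pi (star a) = adjoint (pi a) ;
  gns_state : forall a, inner H (pi a xi) xi = h a ;
  gns_cyclic : closure (range (fun a => pi a xi)) = [set: H]
}.

Definition Linfty (pi : A -> H -> H) : set (H -> H) :=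
  von_neumann_generated (range pi).

Definition even_subalgebra n (U : 'M[A]_n) (pi : A -> H -> H) : set (H -> H) :=
  von_neumann_generated
    [set T | exists i j k l, T = pi (U i j * U k l)].

End Linfty.

(* Main.v *)
(* The automorphism u_ij |-> -u_ij preserves the Haar state, so it is implemented
   on H by a self-adjoint unitary W fixing xi, and x |-> (x + W x W) / 2 is the
   expectation. Its range is M cap {W}', which is N: an operator T commuting with
   the even generators is T_1 + W T_2 with T_1, T_2 in the commutant of M.
   The first row of U consists of odd elements r_k with sum r_k r_k^* = 1.
   Gram-Schmidt with polar decompositions turns it into odd partial isometries
   V_k of M with V_j^* V_k = 0 for j <> k and sum V_k V_k^* = 1, and then
   1, V_1, ..., V_n is an orthonormal basis, as y = sum V_k (V_k^* y) with
   V_k^* y in N for odd y in M.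
   The partial isometry V of the polar decomposition is the strong limit of the
   Newton-Schulz iteration X <- X (3 - X^* X) / 2. *)

Require Import Defs.
From HB Require Import structures.
From mathcomp Require Import all_boot all_order all_algebra.
From mathcomp Require Import sesquilinear.
From mathcomp Require Import all_classical all_reals all_analysis.
From mathcomp Require Import complex ring lra.

Set Implicit Arguments.
Unset Strict Implicit.
Unset Printing Implicit Defensive.

Import Order.TTheory GRing.Theory Num.Theory.
Import numFieldNormedType.Exports.

Local Open Scope classical_set_scope.
Local Open Scope ring_scope.
Local Open Scope complex_scope.

(** The iteration replaces functional calculus: each iterate is T times a polynomial in P = T^* T,
    so all estimates reduce to p(P) >= 0 for operators 0 <= P <= 1. This holds for every p
    generated, with nonnegative coefficients, by the products X^a (1 - X)^b, and explicit identities
    put the relevant differences of iterates in that form. The iteration also keeps symmetries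
    visible: an operator that commutes (or anticommutes) with T and T^* does so with every iterate,
    hence with the limit. This is why V stays in M and stays odd.

    On the algebraic side everything rests on the universal property. It yields u_ij |-> -u_ij, and
    also an induction principle over generators. Invariance of the Haar state comes from evaluating
    h (x) h on (alpha (x) id) Delta(a) in two ways. Finally, F Fbar = c with c nonzero makes F
    invertible, so each u_ij^* is a linear combination of the u_kl. Hence a product of two elements,
    each a generator or the adjoint of one, lies in the span of the u_ij u_kl, and an operator
    commuting with the even generators commutes with all such products. *)

(** * Real-valued norm and inner product, completeness, closure and boundedness *)

Section HilbertSpace.
Variables (R : realType) (H : hilbertSpace R).
Local Notation C := R[i].
Local Notation "'[ x , y ]" := (inner H x y).
Implicit Types (u v w : H).

Lemma inner_addl u v w : '[u + v, w] = '[u, w] + '[v, w].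
Proof. exact: linearDl. Qed.
Lemma inner_scalel (k : C) u v : '[k *: u, v] = k * '[u, v].
Proof. exact: linearZl_LR. Qed.
Lemma inner_addr u v w : '[u, v + w] = '[u, v] + '[u, w].
Proof. exact: linearDr. Qed.
Lemma inner_scaler (k : C) u v : '[u, k *: v] = k^* * '[u, v].
Proof. exact: linearZr_LR. Qed.
Lemma inner_conj u v : '[u, v] = '[v, u]^*.
Proof. by rewrite hermC expr0 mul1r. Qed.
Lemma inner_subl u v w : '[u - v, w] = '[u, w] - '[v, w].
Proof. exact: linearBl. Qed.
Lemma inner_subr u v w : '[u, v - w] = '[u, v] - '[u, w].
Proof. exact: linearBr. Qed.
Lemma inner_oppl u v : '[- u, v] = - '[u, v].
Proof. exact: linearNl. Qed.
Lemma inner_oppr u v : '[u, - v] = - '[u, v].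
Proof. exact: linearNr. Qed.
Lemma inner0l u : '[0, u] = 0. Proof. exact: linear0l. Qed.
Lemma inner0r u : '[u, 0] = 0. Proof. exact: linear0r. Qed.

(** The norm of a module over [R[i]] takes values in [R[i]]; its real part carries all of it
    ([nrmE]) and brings the estimates into the ordered field [R]. *)
Definition nrm v : R := complex.Re `|v|.

Lemma nrmE v : `|v| = (nrm v)%:C.
Proof.
have := normr_ge0 v; rewrite /nrm; case: `|v| => a b.
by rewrite lecE /= => /andP[/eqP -> _].
Qed.

Lemma nrm_ge0 v : 0 <= nrm v.
Proof. by have := normr_ge0 v; rewrite nrmE lecR. Qed.

Lemma nrm_triangle u v : nrm (u + v) <= nrm u + nrm v.
Proof. by rewrite -lecR rmorphD /= -!nrmE; exact: ler_normD. Qed.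

Lemma nrm_distC u v : nrm (u - v) = nrm (v - u).
Proof. by rewrite /nrm distrC. Qed.

Lemma nrm0 : nrm 0 = 0. Proof. by rewrite /nrm normr0. Qed.

Lemma nrm_eq0 v : nrm v = 0 -> v = 0.
Proof. by move=> e; apply/eqP; rewrite -normr_eq0 nrmE e. Qed.

Lemma nrm_scaleR (k : R) v : nrm (k%:C *: v) = `|k| * nrm v.
Proof.
rewrite /nrm normrZ nrmE.
have -> : `|k%:C| = `|k|%:C by rewrite normc_def /= expr0n addr0 sqrtr_sqr.
by rewrite -rmorphM.
Qed.

(** This makes [H] a real inner product space; [inner_rin] recovers the complex product from
    [rin u v] and [rin u ('i *: v)]. *)
Definition rin u v : R := complex.Re '[u, v].

Lemma rin_nrm v : rin v v = nrm v ^+ 2.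
Proof. by rewrite /rin -hilbert_normE nrmE -rmorphXn. Qed.

Lemma inner_nrm v : '[v, v] = (nrm v ^+ 2)%:C.
Proof. by rewrite -hilbert_normE nrmE rmorphXn. Qed.

Lemma rinC u v : rin u v = rin v u.
Proof. by rewrite /rin inner_conj; case: ('[v, u]). Qed.
Lemma rin_addl u v w : rin (u + v) w = rin u w + rin v w.
Proof. by rewrite /rin inner_addl raddfD. Qed.
Lemma rin_addr u v w : rin u (v + w) = rin u v + rin u w.
Proof. by rewrite /rin inner_addr raddfD. Qed.
Lemma rin_subl u v w : rin (u - v) w = rin u w - rin v w.
Proof. by rewrite /rin inner_subl raddfB. Qed.
Lemma rin_subr u v w : rin u (v - w) = rin u v - rin u w.
Proof. by rewrite /rin inner_subr raddfB. Qed.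
Lemma rin_scalel (k : R) u v : rin (k%:C *: u) v = k * rin u v.
Proof.
by rewrite /rin inner_scalel; case: ('[u, v]) => a b /=; rewrite mul0r subr0.
Qed.
Lemma rin_scaler (k : R) u v : rin u (k%:C *: v) = k * rin u v.
Proof. by rewrite rinC rin_scalel rinC. Qed.

Lemma rin_ext u v : (forall w, rin u w = rin v w) -> u = v.
Proof.
move=> e; apply/eqP; rewrite -subr_eq0; apply/eqP/nrm_eq0.
by apply/eqP; rewrite -sqrf_eq0 -rin_nrm rin_subl e subrr.
Qed.

Lemma inner_rin u v : '[u, v] = rin u v +i* rin u ('i *: v).
Proof.
rewrite /rin inner_scaler /=; case: ('[u, v]) => a b /=.
by congr (_ +i* _); rewrite mul0r mulN1r opprK add0r.
Qed.

Lemma inner_ext u v : (forall w, '[u, w] = '[v, w]) -> u = v.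
Proof. by move=> e; apply: rin_ext => w; rewrite /rin e. Qed.

Lemma inner_extr u v : (forall w, '[w, u] = '[w, v]) -> u = v.
Proof. by move=> e; apply: inner_ext => w; rewrite inner_conj e -inner_conj. Qed.

(** For nonzero vectors, with a and b the norms of [u] and [v] and r = [rin u v], the square of the
    norm of b u - a v equals 2 a b (a b - r). *)
Lemma rin_CS u v : rin u v <= nrm u * nrm v.
Proof.
have pos x : x != 0 -> 0 < nrm x.
  rewrite lt_neqAle nrm_ge0 andbT eq_sym => x0.
  by apply: contraNN x0 => /eqP/esym/nrm_eq0->.
have [->|/pos v0] := eqVneq v 0; first by rewrite nrm0 mulr0 /rin inner0r.
have [->|/pos u0] := eqVneq u 0; first by rewrite nrm0 mul0r /rin inner0l.
have := sqr_ge0 (nrm ((nrm v)%:C *: u - (nrm u)%:C *: v)).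
rewrite -rin_nrm rin_subl !rin_subr !rin_scalel !rin_scaler !rin_nrm (rinC v u).
move: (nrm u) (nrm v) u0 v0 (rin u v) => a b a0 b0 r hr.
have : 0 <= (a * b) * (a * b - r) by nra.
by rewrite pmulr_rge0 ?mulr_gt0// subr_ge0.
Qed.

Lemma nrm_sqrD u v : nrm (u + v) ^+ 2 = nrm u ^+ 2 + 2 * rin u v + nrm v ^+ 2.
Proof.
by rewrite -!rin_nrm rin_addl !rin_addr (rinC v u); ring.
Qed.

Lemma nrm_sqrB u v : nrm (u - v) ^+ 2 = nrm u ^+ 2 - 2 * rin u v + nrm v ^+ 2.
Proof.
by rewrite -!rin_nrm rin_subl !rin_subr (rinC v u); ring.
Qed.

Lemma parallelogram u v :
  nrm (u + v) ^+ 2 + nrm (u - v) ^+ 2 = 2 * nrm u ^+ 2 + 2 * nrm v ^+ 2.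
Proof. by rewrite nrm_sqrB nrm_sqrD; ring. Qed.

Lemma cvg_nrmP (x : nat -> H) l :
  (x n @[n --> \oo] --> l) <->
  (forall e : R, 0 < e -> exists N, forall n, (N <= n)%N -> nrm (x n - l) < e).
Proof.
split=> [/cvgrPdist_lt h e e0|h].
  have [] := h e%:C; first by rewrite ltcR.
  move=> N _ hN; exists N => n /hN /=.
  by rewrite nrmE ltcR nrm_distC.
apply/cvgrPdist_lt => -[e e']; rewrite ltcE /= => /andP[/eqP -> e0].
have [N hN] := h _ e0; exists N => // n /hN /=.
by rewrite nrmE ltcR nrm_distC.
Qed.

Lemma nrm_complete (x : nat -> H) :
  (forall e : R, 0 < e -> exists N, forall m n, (N <= m)%N -> (N <= n)%N ->
     nrm (x m - x n) < e) ->
  exists l : H, x n @[n --> \oo] --> l.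
Proof.
move=> h; suff /cvg_ex : cvg (x n @[n --> \oo]) by [].
apply/cauchy_cvgP/cauchy_exP => -[e e'].
rewrite ltcE /= => /andP[/eqP -> e0].
have [N hN] := h _ e0; exists (x N), N => // n /= Nn.
by rewrite -ball_normE /= nrmE ltcR; exact: hN.
Qed.

Lemma closure_nrmP (A : set H) v :
  closure A v <-> forall e : R, 0 < e -> exists2 a, A a & nrm (v - a) < e.
Proof.
split=> [h e e0|h B].
  have [] := h (ball v e%:C); first by apply: nbhsx_ballx; rewrite ltcR.
  by move=> a [Aa]; rewrite -ball_normE /= nrmE ltcR; exists a.
move=> /nbhs_ballP[[e e']] /=; rewrite ltcE /= => /andP[/eqP -> e0] hB.
have [a Aa va] := h _ e0; exists a; split=> //; apply: hB.
by rewrite -ball_normE /= nrmE ltcR.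
Qed.

Section LinearOperators.
Variables (T : H -> H) (linT : linear T).
Let f := HB.pack_for {linear H -> H} T (GRing.isLinear.Build C H H *:%R T linT).
Lemma op0 : T 0 = 0. Proof. exact: (linear0 f). Qed.
Lemma opD v w : T (v + w) = T v + T w. Proof. exact: (linearD f). Qed.
Lemma opB v w : T (v - w) = T v - T w. Proof. exact: (linearB f). Qed.
Lemma opN v : T (- v) = - T v. Proof. exact: (linearN f). Qed.
Lemma opZ k v : T (k *: v) = k *: T v. Proof. exact: (linearZ_LR f). Qed.
Lemma op_sum I (r : seq I) (P : pred I) (g : I -> H) :
  T (\sum_(i <- r | P i) g i) = \sum_(i <- r | P i) T (g i).
Proof. exact: (linear_sum f). Qed.
End LinearOperators.

Lemma bounded_operatorP (T : H -> H) : bounded_operator T <->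
  linear T /\ exists2 K : R, 0 < K & forall v, nrm (T v) <= K * nrm v.
Proof.
split=> [[lT cT]|[lT [K K0 hK]]]; split=> //.
  have T0 := op0 lT; have TZ := opZ lT.
  have /cvgrPdist_lt /(_ 1 ltr01) := cT 0.
  rewrite T0 => /nbhs_ballP[[d d']] /=; rewrite ltcE /= => /andP[/eqP -> d0] hd.
  have d2 : 0 < d / 2 by rewrite divr_gt0.
  exists (d / 2)^-1 => [|v]; first by rewrite invr_gt0.
  have [->|v0] := eqVneq v 0; first by rewrite T0 nrm0 mulr0.
  have nv : 0 < nrm v.
    rewrite lt_neqAle nrm_ge0 andbT eq_sym.
    by apply: contraNN v0 => /eqP/nrm_eq0->.
  (* The vector is rescaled to norm [d / 2], strictly inside the ball of radius [d] on which the
     values of [T] have norm below 1. *)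
  have := hd ((d / 2 / nrm v)%:C *: v).
  rewrite -ball_normE /= !sub0r !normrN !nrmE !ltcR TZ !nrm_scaleR.
  rewrite ger0_norm; last by rewrite divr_ge0 ?nrm_ge0// ltW.
  rewrite divfK ?gt_eqF// ltr_pdivrMr// ltr_pMr// ltr1n.
  move=> /(_ isT); rewrite mulrAC ltr_pdivrMr// mul1r => /ltW h.
  by rewrite (mulrC _^-1) ler_pdivlMr// mulrC.
move=> v; apply/cvgrPdist_lt => -[e e']; rewrite ltcE /= => /andP[/eqP -> e0].
apply/nbhs_ballP; exists (e / K)%:C => /=; first by rewrite ltcR divr_gt0.
move=> w; rewrite -ball_normE /= !nrmE !ltcR ltr_pdivlMr// => h.
by rewrite -opB// (le_lt_trans (hK _))// mulrC.
Qed.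

End HilbertSpace.

(** * Riesz representation and existence of adjoints *)

Section Adjoint.
Variables (R : realType) (H : hilbertSpace R).
Local Notation C := R[i].
Local Notation "'[ x , y ]" := (inner H x y).
Local Notation rin := (@rin R H).
Implicit Types (u v w : H) (S T : H -> H).

(** The representing vector minimizes |v|^2 - 2 g(v). The parallelogram identity makes a minimizing
    sequence Cauchy, and the vanishing of the first variation at its limit is the claim. *)
Lemma riesz_real (g : H -> R) (K : R) :
  (forall (k : R) u v, g (k%:C *: u + v) = k * g u + g v) ->
  (forall v, `|g v| <= K * nrm v) ->
  exists z, forall v, g v = rin v z.
Proof.
move=> lg bg.
have gD u v : g (u + v) = g u + g v.
  by have := lg 1 u v; rewrite scale1r mul1r.
have g0 : g 0 = 0 by have := gD 0 0; rewrite addr0; lra.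
have gZ (k : R) u : g (k%:C *: u) = k * g u.
  by have := lg k u 0; rewrite g0 !addr0.
pose phi v := nrm v ^+ 2 - 2 * g v.
pose I := inf (range phi).
have hI : has_inf (range phi).
  split; first by exists (phi 0), 0.
  exists (- K ^+ 2) => _ [v _ <-]; rewrite /phi.
  have := bg v; have := nrm_ge0 v; have := ler_norm (g v).
  move: (nrm v) (g v) => a b h1 h2 h3.
  have : 0 <= (a - K) ^+ 2 by exact: sqr_ge0.
  by nra.
have Ile v : I <= phi v by apply: ge_inf; [exact: hI.2|exists v].
have /choice [x hx] : forall n : nat, exists v, phi v < I + n.+1%:R^-1.
  move=> n; have [] := @inf_adherent _ (range phi) (n.+1%:R^-1) _ hI.
    by rewrite invr_gt0.
  by move=> _ [v _ <-] hv; exists v.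
have [z hz] : exists z : H, x n @[n --> \oo] --> z.
  apply: nrm_complete => e e0.
  (* Comparing [phi] at the midpoint of [x m] and [x n] with the infimum bounds the squared distance
     by twice the sum of the two errors, hence the factor 4. *)
  have e2 : 0 < e ^+ 2 / 4 by rewrite divr_gt0// exprn_gt0.
  have [N _ hN] := near_infty_natSinv_lt (PosNum e2).
  exists N => m n Nm Nn.
  have := Ile ((2^-1)%:C *: (x m + x n)).
  rewrite /phi nrm_scaleR gZ exprMn gD.
  have := parallelogram (x m) (x n).
  have := hx m; have := hx n; rewrite /phi.
  have := hN _ Nm; have := hN _ Nn => /=.
  have -> : `|2^-1 : R| ^+ 2 = 4^-1.
    by rewrite ger0_norm ?invr_ge0// exprVn -natrX.
  have := nrm_ge0 (x m - x n).
  move: (nrm (x m - x n)) (nrm (x m + x n)) (nrm (x m)) (nrm (x n)) => d s a b.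
  move: (g (x m)) (g (x n)) (n.+1%:R^-1 : R) (m.+1%:R^-1 : R).
  move=> ga gb rn rm d0 h1 h2 h3 h4 h5 h6.
  have : d ^+ 2 < e ^+ 2 by lra.
  by rewrite ltr_pXn2r// nnegrE ltW.
exists z => w.
(* The right side is phi(t w + z) - phi(z). It is bounded below up to an error [e] along the
   minimizing sequence, as only the values [phi (x n)] have been compared with the infimum. *)
have key (t : R) : 0 <= t ^+ 2 * nrm w ^+ 2 + 2 * t * (rin w z - g w).
  suff h (e : R) : 0 < e ->
      0 <= t ^+ 2 * nrm w ^+ 2 + 2 * t * (rin w z - g w) + e.
    exact/ler_addgt0Pr.
  move=> e0.
  have e2 : 0 < e / 2 by rewrite divr_gt0.
  have c0 : 0 < 2 * `|t| * nrm w + 1.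
    by rewrite ltr_wpDl// !mulr_ge0// nrm_ge0.
  have [N1 _ hN1] := near_infty_natSinv_lt (PosNum e2).
  have [N2 hN2] := (cvg_nrmP _ _).1 hz _ (divr_gt0 e2 c0).
  pose n := maxn N1 N2.
  have := hN1 n (leq_maxl _ _) => /=.
  have := hN2 n (leq_maxr _ _); rewrite ltr_pdivlMr// => h2 h1.
  have := Ile (t%:C *: w + x n); rewrite /phi lg nrm_sqrD rin_scalel nrm_scaleR.
  have := hx n; rewrite /phi exprMn real_normK ?num_real// => h3 h4.
  have h5 : 2 * t * rin w (x n) <=
      2 * t * rin w z + 2 * `|t| * nrm w * nrm (x n - z).
    have : 2 * t * rin w (x n - z) <= 2 * (`|t| * (nrm w * nrm (x n - z))).
      rewrite -mulrA ler_pM2l// -rin_scalel.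
      by rewrite (le_trans (rin_CS _ _))// nrm_scaleR mulrA.
    by rewrite rin_subr; lra.
  have := nrm_ge0 (x n - z).
  move: h1 h2 h3 h4 h5; move: (n.+1%:R^-1 : R) (rin w (x n)) (rin w z) (g w).
  move: (g (x n)) (nrm (x n - z)) (nrm (x n)) (nrm w) `|t| => g1 d m y t' r a b c.
  clear -e0; move: I => J h1 h2 h3 h4 h5 d0; nra.
(* Nearly the minimizer of the quadratic in [t]; the added 1 keeps the denominator positive when [w]
   is zero. *)
have := key (- (rin w z - g w) / (nrm w ^+ 2 + 1)).
have := sqr_ge0 (nrm w); move: (nrm w ^+ 2) => a a0.
set d := rin w z - g w => h.
suff : d = 0 by rewrite /d; lra.
have a1 : 0 < a + 1 by lra.
have : 0 <= - (d ^+ 2 * (a + 2)) / (a + 1) ^+ 2.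
  suff -> : - (d ^+ 2 * (a + 2)) / (a + 1) ^+ 2 =
    (- d / (a + 1)) ^+ 2 * a + 2 * (- d / (a + 1)) * d by [].
  by field; rewrite gt_eqF.
rewrite pmulr_lge0 ?invr_gt0 ?exprn_gt0// oppr_ge0.
rewrite pmulr_lle0 ?ltr_wpDl// => d2.
by apply/eqP; rewrite -sqrf_eq0 eq_le d2 sqr_ge0.
Qed.

(** |S v|^2 is the real part of <T (S v), v>, hence at most K |S v| |v|; a nonzero factor |S v|
    cancels. *)
Lemma adj_nrm_le T S (K : R) : (forall v w, '[T v, w] = '[v, S w]) -> 0 <= K ->
  (forall v, nrm (T v) <= K * nrm v) -> forall v, nrm (S v) <= K * nrm v.
Proof.
move=> adj K0 hK v; have [->|/eqP n0] := eqVneq (nrm (S v)) 0.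
  by rewrite mulr_ge0 ?nrm_ge0.
have n1 : 0 < nrm (S v) by rewrite lt_neqAle nrm_ge0 andbT eq_sym; exact/eqP.
rewrite -(ler_pM2l n1) -expr2 -rin_nrm /rin -adj (le_trans (rin_CS _ _))//.
by rewrite mulrCA mulrA ler_wpM2r ?nrm_ge0.
Qed.

(** Riesz represents only the real functional [rin (T v) w] of [v]. The imaginary part follows
    because [T] commutes with multiplication by -i, which turns one part into the other. *)
Lemma adjoint_exists T : bounded_operator T ->
  exists S, bounded_operator S /\ forall v w, '[T v, w] = '[v, S w].
Proof.
move=> bT; have [lT [K K0 hK]] := (bounded_operatorP T).1 bT.
have h w : exists z, forall v, rin (T v) w = rin v z.
  apply: (@riesz_real _ (K * nrm w)) => [k u v|v].
    by rewrite opD// opZ// rin_addl rin_scalel.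
  rewrite ler_norml; apply/andP; split.
    rewrite lerNl -mulN1r -rin_scalel.
    rewrite (le_trans (rin_CS _ _))// nrm_scaleR normrN1 mul1r mulrAC.
    by rewrite ler_wpM2r// nrm_ge0.
  by rewrite (le_trans (rin_CS _ _))// mulrAC ler_wpM2r// nrm_ge0.
have [S hS] := choice h.
have adj v w : '[T v, w] = '[v, S w].
  rewrite !inner_rin hS; congr (_ +i* _).
  have E a b : rin a ('i *: b) = rin (- 'i *: a) b.
    by rewrite /rin inner_scaler inner_scalel conjCi.
  by rewrite !E -hS opZ.
have lS : linear S.
  move=> k u v; apply: inner_extr => w.
  by rewrite -adj !inner_addr !inner_scaler !adj.
exists S; split=> //; apply/bounded_operatorP; split=> //.
by exists K => //; apply: adj_nrm_le adj _ hK; exact: ltW.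
Qed.

Lemma adjointP T : bounded_operator T ->
  bounded_operator (adjoint T) /\ forall v w, '[T v, w] = '[v, adjoint T w].
Proof.
by move=> /adjoint_exists[S hS]; rewrite /adjoint; case: xgetP => // /(_ S).
Qed.

Lemma adjoint_unique T S : bounded_operator T ->
  (forall v w, '[T v, w] = '[v, S w]) -> adjoint T = S.
Proof.
move=> bT h; apply/funext => w; apply: inner_extr => v.
by rewrite -(adjointP bT).2 h.
Qed.

End Adjoint.

(** * Positivity certificates for the Newton-Schulz polynomials *)

Section Cone.
Variable R : realType.
Implicit Types (p q r : {poly R}) (a b : nat) (c : R).

(* Membership certifies positivity of [p(P)] for every operator [0 <= P <= 1]
   without appealing to a spectral theorem. *)
Inductive cone : {poly R} -> Prop :=
| cone_monomial a b : cone ('X^a * (1 - 'X) ^+ b)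
| cone_add p q : cone p -> cone q -> cone (p + q)
| cone_scale c p : 0 <= c -> cone p -> cone (c%:P * p).

Lemma cone_mul p q : cone p -> cone q -> cone (p * q).
Proof.
move=> cp cq; elim: cp => [a b|r s _ hr _ hs|c r c0 _ hr].
- elim: cq => [a' b'|r s _ hr _ hs|c r c0 _ hr].
  + rewrite mulrACA -!exprD; exact: cone_monomial.
  + rewrite mulrDr; exact: cone_add.
  + rewrite mulrCA; exact: cone_scale.
- rewrite mulrDl; exact: cone_add.
- rewrite -mulrA; exact: cone_scale.
Qed.

Lemma coneC c : 0 <= c -> cone c%:P.
Proof.
by move=> c0; have := cone_scale c0 (cone_monomial 0 0); rewrite !expr0 !mulr1.
Qed.

Lemma coneX : cone 'X.
Proof. by have := cone_monomial 1 0; rewrite expr0 mulr1. Qed.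

Let half : {poly R} := (2^-1)%:P.

Let half2 : half * 2 = 1.
Proof. by rewrite /half -polyC_natr -polyCM mulVf. Qed.

(* The iterate [X_k] is [T q_k(T^* T)], and [X_k^* X_k] is [y_k(T^* T)]. *)
Fixpoint newton_schulz k : {poly R} :=
  if k is k'.+1 then
    (2^-1)%:P * newton_schulz k' * (3 - 'X * newton_schulz k' ^+ 2)
  else 1.
Local Notation q := newton_schulz.

Definition newton_schulz_sq k : {poly R} := 'X * q k ^+ 2.
Local Notation y := newton_schulz_sq.

(** Writing w = 1 - y_k, one has q_(k+1) = q_k (2 + w) / 2 and 1 - y_(k+1) = w^2 (3 + w) / 4. The
    first identity needs the second claim at k, hence the joint induction. *)
Lemma cone_newton_schulz k : cone (q k) /\ cone (1 - y k).
Proof.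
have cn n : cone n%:R by rewrite -polyC_natr; exact/coneC/ler0n.
have ch : cone half by apply: coneC; rewrite invr_ge0.
elim: k => [|k [hq hy]].
  split; first exact: (cn 1%N).
  by rewrite /y expr1n mulr1; have := cone_monomial 0 1; rewrite mul1r expr1.
split.
  have -> : q k.+1 = half * q k * (2 + (1 - y k)).
    by rewrite /= -/half /y; ring.
  by apply: cone_mul; [exact: cone_mul|exact: cone_add].
have -> : 1 - y k.+1 = half * half * ((1 - y k) * (1 - y k)) * (3 + (1 - y k)).
  rewrite /y /= -/half; move: (half) half2 (q k) => h h2 p.
  transitivity ((h * 2) ^+ 2 - 'X * (h * p * (3 - 'X * p ^+ 2)) ^+ 2).
    by rewrite h2 expr1n.
  by ring.
by repeat first
  [exact: ch | exact: hy | apply: cn | apply: cone_mul | apply: cone_add].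
Qed.

(** The difference telescopes into terms q_(j+1) - q_j = q_j (1 - y_j) / 2. *)
Lemma cone_newton_schulzB m k : (m <= k)%N -> cone (q k - q m).
Proof.
have cz : cone 0 by rewrite -polyC0; exact: coneC.
move=> /subnK <-; elim: (k - m)%N => [|d hd]; first by rewrite subrr.
rewrite addSn; set j := (d + m)%N in hd *.
have -> : q j.+1 - q m = half * q j * (1 - y j) + (q j - q m).
  rewrite /y /= -/half; move: (half) half2 (q j) (q m) => h h2 p r.
  transitivity (h * p * (3 - 'X * p ^+ 2) - h * 2 * p + (p - r)).
    by rewrite h2; ring.
  by ring.
apply: cone_add => //; have [? ?] := cone_newton_schulz j.
apply: cone_mul => //; apply: cone_mul => //.
by apply: coneC; rewrite invr_ge0.
Qed.

(** The expression equals 2 X q_m (q_k - q_m). For operators it says that |X_k v - X_m v|^2 is at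
    most |X_k v|^2 - |X_m v|^2, which turns monotone norms into Cauchy sequences. *)
Lemma cone_newton_schulz_sqB m k : (m <= k)%N ->
  cone (y k - y m - 'X * (q k - q m) ^+ 2).
Proof.
move=> mk.
have -> : y k - y m - 'X * (q k - q m) ^+ 2 = 2 * 'X * q m * (q k - q m).
  by rewrite /y; ring.
have [? _] := cone_newton_schulz m; have ? := cone_newton_schulzB mk.
do 3 (apply: cone_mul => //); last exact: coneX.
by rewrite -polyC_natr; exact: coneC.
Qed.

Lemma cone_newton_schulz_sq_le m k : (m <= k)%N -> cone (y k - y m).
Proof.
move=> mk; rewrite -[_ - _](subrK ('X * (q k - q m) ^+ 2)).
apply: cone_add; first exact: cone_newton_schulz_sqB.
have ? := cone_newton_schulzB mk.
by apply: cone_mul; [exact: coneX|apply: cone_mul].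
Qed.

End Cone.

(** * Real polynomials of an operator *)

Section PolynomialCalculus.
Variables (R : realType) (H : hilbertSpace R).
Local Notation C := R[i].
Local Notation "'[ x , y ]" := (inner H x y).
Implicit Types (u v w : H) (p q r : {poly R}) (P S T : H -> H).

(** Real coefficients make p(P) self-adjoint along with [P]. *)
Definition op_poly P p v : H := \sum_(i < size p) (p`_i)%:C *: iter i P v.

Lemma op_poly_wide P n p v : (size p <= n)%N ->
  op_poly P p v = \sum_(i < n) (p`_i)%:C *: iter i P v.
Proof.
move=> pn; rewrite /op_poly.
rewrite (big_ord_widen _ (fun i => (p`_i)%:C *: iter i P v) pn).
rewrite big_mkcond; apply: eq_bigr => i _; case: ltnP => // h.
by rewrite nth_default// scale0r.
Qed.

Lemma op_polyD P p q v : op_poly P (p + q) v = op_poly P p v + op_poly P q v.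
Proof.
pose n := maxn (size p) (size q).
rewrite (op_poly_wide P v (size_polyD p q)).
rewrite (op_poly_wide P v (leq_maxl (size p) (size q))).
rewrite (op_poly_wide P v (leq_maxr (size p) (size q))) -big_split /=.
by apply: eq_bigr => i _; rewrite coefD rmorphD scalerDl.
Qed.

Lemma op_polyCM P c p v : op_poly P (c%:P * p) v = c%:C *: op_poly P p v.
Proof.
rewrite (@op_poly_wide P (size p)); last by rewrite mul_polyC size_scale_leq.
by rewrite scaler_sumr; apply: eq_bigr => i _; rewrite coefCM rmorphM scalerA.
Qed.

Lemma op_polyXM P p v : op_poly P (p * 'X) v = op_poly P p (P v).
Proof.
rewrite (@op_poly_wide P (size p).+1).
  rewrite big_ord_recl coefMX /= scale0r add0r.
  by apply: eq_bigr => i _; rewrite coefMX /= -iterSr.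
by rewrite (leq_trans (size_polyMleq _ _))// size_polyX addn2.
Qed.

Lemma op_poly0 P v : op_poly P 0 v = 0.
Proof. by rewrite /op_poly size_poly0 big_ord0. Qed.

Lemma op_poly1 P v : op_poly P 1 v = v.
Proof. by rewrite /op_poly size_poly1 big_ord1 coef1 /= scale1r. Qed.

Lemma op_polyC P c v : op_poly P c%:P v = c%:C *: v.
Proof. by rewrite -[c%:P]mulr1 op_polyCM op_poly1. Qed.

Lemma op_polyX P v : op_poly P 'X v = P v.
Proof. by rewrite -['X]mul1r op_polyXM op_poly1. Qed.

Lemma op_polyB P p q v : op_poly P (p - q) v = op_poly P p v - op_poly P q v.
Proof.
by rewrite op_polyD -[- q]mulN1r -polyCN op_polyCM rmorphN scaleN1r.
Qed.

Lemma op_poly_linear P p : linear P -> linear (op_poly P p).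
Proof.
move=> lP; elim/poly_ind: p => [|p c hp] k u v.
  by rewrite !op_poly0 scaler0 addr0.
rewrite !op_polyD !op_polyXM !op_polyC (opD lP) (opZ lP) hp.
by rewrite !scalerDr !scalerA mulrC addrACA.
Qed.

(** Taking [S] = [P] gives commutation with p(P); taking [S] = [T'], [P] = T T' and [P'] = T' T
    moves [T'] across the polynomial, which is how adjoints of the iterates are computed. *)
Lemma op_poly_intertwine S P P' p v : linear S ->
  (forall u, S (P u) = P' (S u)) ->
  S (op_poly P p v) = op_poly P' p (S v).
Proof.
move=> lS h; elim/poly_ind: p v => [|p c hp] v.
  by rewrite !op_poly0 op0.
by rewrite !op_polyD (opD lS) !op_polyXM hp h !op_polyC (opZ lS).
Qed.

Lemma op_polyM P p q v : linear P ->
  op_poly P (p * q) v = op_poly P p (op_poly P q v).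
Proof.
move=> lP; elim/poly_ind: p v => [|p c hp] v; first by rewrite mul0r !op_poly0.
rewrite mulrDl -mulrA (mulrC 'X) mulrA !op_polyD op_polyCM !op_polyXM hp op_polyC.
by rewrite -(@op_poly_intertwine P P P).
Qed.

Lemma op_poly_selfadj P p u v : linear P ->
  (forall u v, '[P u, v] = '[u, P v]) ->
  '[op_poly P p u, v] = '[u, op_poly P p v].
Proof.
move=> lP aP; elim/poly_ind: p u v => [|p c hp] u v.
  by rewrite !op_poly0 inner0l inner0r.
rewrite !op_polyD inner_addl inner_addr !op_polyXM hp aP; congr (_ + _).
  by rewrite -(@op_poly_intertwine P P P).
by rewrite !op_polyC inner_scalel inner_scaler conj_Creal// complex_real.
Qed.

(** Since s(P) is self-adjoint, positivity of r(P) passes to s(P) r(P) s(P). Extracting such a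
    square from X^a (1 - X)^b leaves 1, X, 1 - X or X (1 - X), and the last one equals (1 - X) X (1
    - X) + X (1 - X) X. *)
Lemma op_poly_cone P p v : linear P ->
  (forall u v, '[P u, v] = '[u, P v]) ->
  (forall u, 0 <= rin (P u) u <= rin u u) ->
  cone p -> 0 <= rin (op_poly P p v) v.
Proof.
move=> lP aP bP.
have sq s r u : (forall w, 0 <= rin (op_poly P r w) w) ->
    0 <= rin (op_poly P (s * r * s) u) u.
  move=> h; rewrite -mulrA op_polyM// /rin op_poly_selfadj// op_polyM//.
  exact: h.
have gX w : 0 <= rin (op_poly P 'X w) w.
  by rewrite op_polyX; case/andP: (bP w).
have gX1 w : 0 <= rin (op_poly P (1 - 'X) w) w.
  by rewrite op_polyB op_poly1 op_polyX rin_subl subr_ge0; case/andP: (bP w).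
have gXX w : 0 <= rin (op_poly P ('X * (1 - 'X)) w) w.
  have -> : ('X : {poly R}) * (1 - 'X) =
      (1 - 'X) * 'X * (1 - 'X) + 'X * (1 - 'X) * 'X.
    by ring.
  by rewrite op_polyD rin_addl addr_ge0//; apply: sq.
move=> cp; elim: cp v => [a b|r s _ hr _ hs|c r c0 _ hr] v.
- pose s : {poly R} := 'X^(a./2) * (1 - 'X) ^+ b./2.
  have -> : 'X^a * (1 - 'X) ^+ b = s * ('X ^+ odd a * (1 - 'X) ^+ odd b) * s.
    rewrite -{1}(odd_double_half a) -{1}(odd_double_half b) -!addnn !exprD /s.
    by ring.
  apply: sq => w; case: (odd a); case: (odd b);
    rewrite ?expr0 ?expr1 ?mulr1 ?mul1r//.
  by rewrite op_poly1 rin_nrm sqr_ge0.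
- by rewrite op_polyD rin_addl addr_ge0.
- by rewrite op_polyCM rin_scalel mulr_ge0.
Qed.

End PolynomialCalculus.

(** * Strong limits of sequences of operators *)

Section StrongLimits.
Variables (R : realType) (H : hilbertSpace R).
Local Notation "'[ x , y ]" := (inner H x y).
Implicit Types (u v w : H) (S T V : H -> H).

Lemma cvg_bounded S (x : nat -> H) (l : H) : bounded_operator S ->
  x n @[n --> \oo] --> l -> S (x n) @[n --> \oo] --> S l.
Proof. by move=> [_ cS] h; apply: continuous_cvg => //; exact: cS. Qed.

Lemma cvg_nrm_le (x : nat -> H) (l : H) (K : R) : x n @[n --> \oo] --> l ->
  (forall n, nrm (x n) <= K) -> nrm l <= K.
Proof.
move=> /cvg_nrmP h hK; apply/ler_addgt0Pr => e e0; have [N hN] := h _ e0.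
rewrite -[l](subrK (x N)) (le_trans (nrm_triangle _ _))// addrC lerD//.
by rewrite nrm_distC ltW// hN.
Qed.

Lemma cvg_rin (x : nat -> H) (l : H) w : x n @[n --> \oo] --> l ->
  rin (x n) w @[n --> \oo] --> rin l w.
Proof.
move=> /cvg_nrmP h; apply/cvgrPdist_lt => e e0.
have w1 : 0 < nrm w + 1 by rewrite ltr_wpDl// nrm_ge0.
have [N hN] := h _ (divr_gt0 e0 w1); exists N => // n /hN /=.
rewrite ltr_pdivlMr// nrm_distC -rin_subl.
have : `|rin (l - x n) w| <= nrm (l - x n) * nrm w.
  rewrite ler_norml rin_CS andbT lerNl -mulN1r -rin_scalel.
  by rewrite (le_trans (rin_CS _ _))// nrm_scaleR normrN1 mul1r.
have := nrm_ge0 (l - x n).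
by move: `|_| (nrm _) (nrm _) => a b c; nra.
Qed.

Lemma cvg_adj (x x' : nat -> H) (l l' : H) u v :
  x n @[n --> \oo] --> l -> x' n @[n --> \oo] --> l' ->
  (forall n, '[x n, v] = '[u, x' n]) -> '[l, v] = '[u, l'].
Proof.
move=> hx hx' h.
have key w (z : nat -> H) (z' : H) : z n @[n --> \oo] --> z' ->
    (forall n, rin (x n) w = rin u (z n)) -> rin l w = rin u z'.
  move=> hz e; have := cvg_rin (w := w) hx.
  have -> : (fun n => rin (x n) w) = (fun n => rin (z n) u).
    by apply/funext => n; rewrite e rinC.
  rewrite [RHS]rinC => h1; have h2 := cvg_rin (w := u) hz.
  by rewrite -(cvg_lim (@Rhausdorff R) h1) -(cvg_lim (@Rhausdorff R) h2).
rewrite !inner_rin; congr (_ +i* _).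
  by apply: (key _ _ _ hx') => n; rewrite /rin h.
apply: (key _ (fun n => 'i *: x' n) ('i *: l')) => [|n]; first exact: cvgZl_tmp.
by have := h n; rewrite !inner_rin => -[].
Qed.

(** The uniform bound lets operators and arguments vary together, so that strong limits of products
    such as X_k X_k^* X_k can be taken. *)
Lemma cvg_contraction (X : nat -> H -> H) V (x : nat -> H) (l : H) :
  (forall k, linear (X k)) -> (forall k v, nrm (X k v) <= nrm v) ->
  (forall v, X k v @[k --> \oo] --> V v) ->
  x k @[k --> \oo] --> l -> X k (x k) @[k --> \oo] --> V l.
Proof.
move=> lX bX cX /cvg_nrmP cx; apply/cvg_nrmP => e e0.
have e2 : 0 < e / 2 by rewrite divr_gt0.
have [N1 h1] := cx _ e2; have [N2 h2] := (cvg_nrmP _ _).1 (cX l) _ e2.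
exists (maxn N1 N2) => n; rewrite geq_max => /andP[/h1 n1 /h2 n2].
have -> : X n (x n) - V l = X n (x n - l) + (X n l - V l).
  by rewrite (opB (lX n)) addrA subrK.
rewrite (le_lt_trans (nrm_triangle _ _))// (splitr e) ltrD//.
by rewrite (le_lt_trans (bX _ _)).
Qed.
End StrongLimits.

(** * The partial isometry of the polar decomposition *)

Section PolarPart.
Variables (R : realType) (H : hilbertSpace R).
Local Notation "'[ x , y ]" := (inner H x y).
Implicit Types (u v w : H) (S T V : H -> H).
Local Notation q := (newton_schulz R).
Local Notation y := (newton_schulz_sq R).

(** The adjoint enters as a separate argument [T'], so that exchanging the two arguments gives the
    adjoint iteration. *)
Definition newton_schulz_op T T' k v := T (op_poly (T' \o T) (q k) v).

Section Contraction.
Variables T T' : H -> H.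
Hypotheses (bT : bounded_operator T) (bT' : bounded_operator T').
Hypothesis adjT : forall u v, '[T u, v] = '[u, T' v].
Hypothesis contT : forall v, nrm (T v) <= nrm v.
Let P := T' \o T.
Local Notation X := (newton_schulz_op T T').

Let linT : linear T. Proof. exact: bT.1. Qed.
Let linT' : linear T'. Proof. exact: bT'.1. Qed.
Let linP : linear P.
Proof. by move=> k u v; rewrite /P /= (opD linT) (opZ linT) linT'. Qed.

Let adjT' u v : '[T' u, v] = '[u, T v].
Proof. by rewrite inner_conj -adjT -inner_conj. Qed.

Let selfP u v : '[P u, v] = '[u, P v].
Proof. by rewrite /P /= adjT' adjT. Qed.

Let boundP v : 0 <= rin (P v) v <= rin v v.
Proof.
rewrite /rin /P /= adjT' -!/(rin _ _) !rin_nrm sqr_ge0 /=.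
by rewrite lerXn2r// nnegrE nrm_ge0.
Qed.

Lemma newton_schulz_op_linear k : linear (X k).
Proof.
move=> c u v; rewrite /newton_schulz_op (op_poly_linear (q k) linP).
by rewrite (opD linT) (opZ linT).
Qed.

Let nrm_poly p v :
  nrm (T (op_poly P p v)) ^+ 2 = rin (op_poly P ('X * p ^+ 2) v) v.
Proof.
rewrite -rin_nrm {1}/rin adjT -[T' _]/(P _) -/(rin _ _) rinC.
have -> : 'X * p ^+ 2 = p * ('X * p) by ring.
by rewrite op_polyM// [in RHS]/rin op_poly_selfadj// op_polyM// op_polyX.
Qed.

Let nrmX k v : nrm (X k v) ^+ 2 = rin (op_poly P (y k) v) v.
Proof. exact: nrm_poly. Qed.

Lemma newton_schulz_op_contraction k v : nrm (X k v) <= nrm v.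
Proof.
rewrite -(ler_pXn2r (n := 2))// ?nnegrE ?nrm_ge0// nrmX -subr_ge0 -rin_nrm.
have := op_poly_cone v linP selfP boundP (cone_newton_schulz R k).2.
by rewrite op_polyB op_poly1 rin_subl.
Qed.

Lemma newton_schulz_op_incr m k v : (m <= k)%N -> nrm (X m v) <= nrm (X k v).
Proof.
move=> mk; rewrite -(ler_pXn2r (n := 2))// ?nnegrE ?nrm_ge0// !nrmX -subr_ge0.
have := op_poly_cone v linP selfP boundP (cone_newton_schulz_sq_le R mk).
by rewrite op_polyB rin_subl.
Qed.

Let nrmXB m k v : (m <= k)%N ->
  nrm (X k v - X m v) ^+ 2 <= nrm (X k v) ^+ 2 - nrm (X m v) ^+ 2.
Proof.
move=> mk; rewrite -subr_ge0.
have := op_poly_cone v linP selfP boundP (cone_newton_schulz_sqB R mk).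
by rewrite !op_polyB !rin_subl -!nrmX -nrm_poly op_polyB (opB linT).
Qed.

(** The numbers |X_k v|^2 increase and are bounded by |v|^2, so they converge; [nrmXB] bounds the
    squared distances of the vectors by differences of these numbers. *)
Lemma newton_schulz_op_cvg v : exists l : H, X k v @[k --> \oo] --> l.
Proof.
apply: nrm_complete => e e0.
pose a k := nrm (X k v) ^+ 2.
have /cvg_cauchy/cauchyP : cvgn a.
  apply: nondecreasing_is_cvgn.
    by move=> m k mk; rewrite lerXn2r// ?nnegrE ?nrm_ge0// newton_schulz_op_incr.
  exists (nrm v ^+ 2) => _ [k _ <-].
  by rewrite lerXn2r// ?nnegrE ?nrm_ge0// newton_schulz_op_contraction.
move=> /(_ (e ^+ 2 / 2)) []; first by rewrite divr_gt0// exprn_gt0.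
move=> z [N _ hN]; exists N.
have wl m n : (N <= m)%N -> (m <= n)%N -> nrm (X n v - X m v) < e.
  move=> Nm mn; rewrite -(ltr_pXn2r (n := 2))// ?nnegrE ?nrm_ge0// ?ltW//.
  rewrite (le_lt_trans (nrmXB v mn))//.
  have := hN _ Nm; have := hN _ (leq_trans Nm mn).
  rewrite /ball /= !ltr_norml /a; lra.
move=> m n Nm Nn; case: (leqP m n) => mn; last by apply: wl => //; exact: ltnW.
by rewrite nrm_distC; exact: wl.
Qed.

Lemma newton_schulz_op_adj k u v :
  '[X k u, v] = '[u, newton_schulz_op T' T k v].
Proof.
rewrite /newton_schulz_op adjT op_poly_selfadj//; congr ('[_, _]).
by rewrite (@op_poly_intertwine _ _ T' (T \o T') (T' \o T)).
Qed.

(** The recursion X_(k+1) = (3 X_k - X_k X_k^* X_k) / 2 in terms of operators, doubled to avoid the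
    fraction. *)
Lemma newton_schulz_opS k v :
  X k.+1 v + X k.+1 v =
  X k v *+ 3 - X k (newton_schulz_op T' T k (X k v)).
Proof.
have E u : newton_schulz_op T' T k u = op_poly P (q k) (T' u).
  rewrite /newton_schulz_op.
  by rewrite (@op_poly_intertwine _ _ T' (T \o T') (T' \o T)).
have -> : X k (newton_schulz_op T' T k (X k v)) =
    T (op_poly P (q k * (q k * ('X * q k))) v).
  by rewrite E !op_polyM// op_polyX.
rewrite /newton_schulz_op -(opD linT) -op_polyD.
have -> : q k.+1 + q k.+1 = q k * 3%:R - q k * (q k * ('X * q k)).
  transitivity (((2^-1)%:P * 2) * (q k * (3 - 'X * q k ^+ 2))).
    by rewrite /=; ring.
  rewrite -polyC_natr -polyCM mulVf// mul1r; ring.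
rewrite op_polyB (opB linT) mulr_natr !mulrSr.
by rewrite !op_polyD !(opD linT) op_poly0 (op0 linT).
Qed.

Definition newton_schulz_lim v : H := lim (X k v @[k --> \oo]).
Local Notation V := newton_schulz_lim.

Lemma newton_schulz_limP v : X k v @[k --> \oo] --> V v.
Proof. by have := newton_schulz_op_cvg v => /cvg_ex. Qed.

Lemma newton_schulz_lim_contraction v : nrm (V v) <= nrm v.
Proof.
apply: (cvg_nrm_le (@newton_schulz_limP v)) => n.
exact: newton_schulz_op_contraction.
Qed.

Lemma newton_schulz_lim_linear : linear V.
Proof.
move=> c u v; apply: cvg_lim; first exact: norm_hausdorff.
under eq_fun do rewrite newton_schulz_op_linear.
apply: cvgD; last exact: newton_schulz_limP.
by apply: cvgZl_tmp; exact: newton_schulz_limP.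
Qed.

Lemma newton_schulz_lim_bounded : bounded_operator V.
Proof.
apply/bounded_operatorP; split; first exact: newton_schulz_lim_linear.
by exists 1 => // v; rewrite mul1r newton_schulz_lim_contraction.
Qed.

(** The norms |X_k v| increase from |X_0 v| = |T v|, so their limit |V v| dominates |T v|. *)
Lemma newton_schulz_lim_eq0 v : V v = 0 -> T v = 0.
Proof.
move=> Vv; apply/nrm_eq0/eqP; rewrite eq_le nrm_ge0 andbT.
have X0 : X 0 v = T v by rewrite /newton_schulz_op op_poly1.
apply/ler_addgt0Pr => e e0.
have [N hN] := (cvg_nrmP _ _).1 (@newton_schulz_limP v) _ e0.
rewrite -X0 add0r (le_trans (newton_schulz_op_incr v (leq0n N)))//.
by have := hN N (leqnn _); rewrite Vv subr0 => /ltW.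
Qed.

(** As c^2 = 1, [S] commutes with T' T and the sign is left to the outer factor [T]. The value c = 1
    keeps the limit in a commutant, c = -1 keeps it odd. *)
Lemma newton_schulz_lim_scomm S (c : R[i]) : c ^+ 2 = 1 -> bounded_operator S ->
  (forall v, S (T v) = c *: T (S v)) -> (forall v, S (T' v) = c *: T' (S v)) ->
  forall v, S (V v) = c *: V (S v).
Proof.
move=> c2 bS ST ST' v.
have SP u : S (P u) = P (S u).
  by rewrite /P /= ST' ST (opZ linT') scalerA -expr2 c2 scale1r.
have SX k : S (X k v) = c *: X k (S v).
  rewrite /newton_schulz_op ST; congr (_ *: T _).
  by rewrite (@op_poly_intertwine _ _ S P P)//; exact: bS.1.
have := cvg_bounded bS (@newton_schulz_limP v).
have -> : (fun k => S (X k v)) = (fun k => c *: X k (S v)) by apply/funext.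
move=> h; apply: (norm_cvg_unique h).
by apply: cvgZl_tmp; exact: newton_schulz_limP.
Qed.

Lemma newton_schulz_lim_annihilated S : bounded_operator S ->
  (forall v, S (T v) = 0) -> forall v, S (V v) = 0.
Proof.
move=> bS ST v; have := cvg_bounded bS (@newton_schulz_limP v).
have -> : (fun k => S (X k v)) = (fun=> 0) by apply/funext => k; exact: ST.
by move=> h; apply: (norm_cvg_unique h); exact: cvg_cst.
Qed.

End Contraction.

Section ContractionPair.
Variables T T' : H -> H.
Hypotheses (bT : bounded_operator T) (bT' : bounded_operator T').
Hypothesis adjT : forall u v, '[T u, v] = '[u, T' v].
Hypotheses (contT : forall v, nrm (T v) <= nrm v)
           (contT' : forall v, nrm (T' v) <= nrm v).
Let adjT' u v : '[T' u, v] = '[u, T v].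
Proof. by rewrite inner_conj -adjT -inner_conj. Qed.
Local Notation V := (newton_schulz_lim T T').
Local Notation V' := (newton_schulz_lim T' T).
Let cV := newton_schulz_limP bT bT' adjT contT.
Let cV' := newton_schulz_limP bT' bT adjT' contT'.
Let bV := newton_schulz_lim_bounded bT bT' adjT contT.

Lemma newton_schulz_lim_adj u v : '[V u, v] = '[u, V' v].
Proof.
apply: (cvg_adj (@cV u) (@cV' v)) => k; exact: newton_schulz_op_adj.
Qed.

(** In the limit the recursion reads 2 V = 3 V - V V' V. *)
Lemma newton_schulz_lim_partial_isometry v : V (V' (V v)) = V v.
Proof.
have h1 : newton_schulz_op T T' k.+1 v + newton_schulz_op T T' k.+1 v @[k --> \oo]
    --> V v + V v.
  have cS : newton_schulz_op T T' k.+1 v @[k --> \oo] --> V v.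
    by rewrite (cvg_shiftS (fun k => newton_schulz_op T T' k v)); exact: cV.
  exact: cvgD.
have h2 : newton_schulz_op T T' k v *+ 3 - newton_schulz_op T T' k
  (newton_schulz_op T' T k (newton_schulz_op T T' k v)) @[k --> \oo] -->
    V v *+ 3 - V (V' (V v)).
  apply: cvgB; first exact: cvgMn.
  apply: (cvg_contraction _ _ (@cV)).
  - exact: newton_schulz_op_linear.
  - exact: newton_schulz_op_contraction.
  apply: (cvg_contraction _ _ (@cV')) (@cV v).
  - exact: newton_schulz_op_linear.
  - exact: newton_schulz_op_contraction.
have e : V v + V v = V v *+ 3 - V (V' (V v)).
  apply: (norm_cvg_unique h1).
  rewrite (_ : (fun k => _) = (fun k => newton_schulz_op T T' k v *+ 3 -
    newton_schulz_op T T' k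
      (newton_schulz_op T' T k (newton_schulz_op T T' k v))))//.
  by apply/funext => k; exact: newton_schulz_opS.
apply/eqP; rewrite -subr_eq0 -opprB oppr_eq0; apply/eqP.
by apply: (addrI (V v + V v)); rewrite addr0 {2}e addrA !mulrSr mulr0n add0r.
Qed.

End ContractionPair.

(** By adjunction it suffices that T' kills V V' w - w. Now V' kills this vector, being a partial
    isometry, and the kernel of V' lies in that of T'. *)
Lemma newton_schulz_lim_support T T' :
  bounded_operator T -> bounded_operator T' ->
  (forall u v, '[T u, v] = '[u, T' v]) ->
  (forall v, nrm (T v) <= nrm v) -> (forall v, nrm (T' v) <= nrm v) ->
  forall v, newton_schulz_lim T T' (newton_schulz_lim T' T (T v)) = T v.
Proof.
move=> bT bT' adjT contT contT' v.
have adjT' u w : '[T' u, w] = '[u, T w] by rewrite inner_conj -adjT -inner_conj.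
have adjV := newton_schulz_lim_adj bT bT' adjT contT contT'.
have adjV' := newton_schulz_lim_adj bT' bT adjT' contT' contT.
have bV' := newton_schulz_lim_bounded bT' bT adjT' contT'.
apply: inner_ext => w; rewrite adjV adjV' !adjT; congr ('[_, _]).
apply/esym/eqP; rewrite -subr_eq0 -(opB bT'.1); apply/eqP.
apply: (newton_schulz_lim_eq0 bT' bT adjT' contT').
by rewrite (opB bV'.1) newton_schulz_lim_partial_isometry // subrr.
Qed.

(* [V V^*] is the range projection of [T]. *)
Lemma polar_part T : bounded_operator T -> exists V, [/\
  bounded_operator V,
  V \o adjoint V \o V = V,
  V \o adjoint V \o T = T,
  forall S (c : R[i]), c ^+ 2 = 1 -> bounded_operator S ->
    (forall v, S (T v) = c *: T (S v)) ->
    (forall v, S (adjoint T v) = c *: adjoint T (S v)) ->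
    forall v, S (V v) = c *: V (S v) &
  forall S, bounded_operator S -> (forall v, S (T v) = 0) ->
    forall v, S (V v) = 0].
Proof.
move=> bT; have [lT [K K0 hK]] := (bounded_operatorP T).1 bT.
have [bT' adjT] := adjointP bT.
have hK' := adj_nrm_le adjT (ltW K0) hK.
(* The iteration is controlled for contractions, so [T] and its adjoint are divided by a common
   bound; each property claimed for V is insensitive to this positive factor. *)
pose scl (S : H -> H) v := (K^-1)%:C *: S v.
have bscl S : bounded_operator S -> (forall v, nrm (S v) <= K * nrm v) ->
    bounded_operator (scl S) /\ forall v, nrm (scl S v) <= nrm v.
  move=> bS hS.
  have hc v : nrm (scl S v) <= nrm v.
    rewrite nrm_scaleR ger0_norm; last by rewrite invr_ge0 ltW.
    by rewrite ler_pdivrMl.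
  split=> //; apply/bounded_operatorP; split; last first.
    by exists 1 => // v; rewrite mul1r.
  by move=> k u v; rewrite /scl bS.1 scalerDr !scalerA mulrC.
have [b1 c1] := bscl _ bT hK; have [b1' c1'] := bscl _ bT' hK'.
have adj1 u v : '[scl T u, v] = '[u, scl (adjoint T) v].
  by rewrite /scl inner_scalel inner_scaler adjT conj_Creal// complex_real.
have adj1' u v : '[u, scl T v] = '[scl (adjoint T) u, v].
  by rewrite [RHS]inner_conj -adj1 -inner_conj.
have bV := newton_schulz_lim_bounded b1 b1' adj1 c1.
exists (newton_schulz_lim (scl T) (scl (adjoint T))).
have -> : adjoint (newton_schulz_lim (scl T) (scl (adjoint T))) =
    newton_schulz_lim (scl (adjoint T)) (scl T).
  by apply: adjoint_unique => // u v; exact: newton_schulz_lim_adj.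
have K1 : K%:C * (K^-1)%:C = 1 by rewrite -rmorphM mulfV// gt_eqF.
have TE v : T v = K%:C *: scl T v by rewrite /scl scalerA K1 scale1r.
split=> //.
- by apply/funext => v /=; exact: newton_schulz_lim_partial_isometry.
- have bV' := newton_schulz_lim_bounded b1' b1 (fun u v => esym (adj1' u v)) c1'.
  apply/funext => v /=; rewrite TE (opZ bV'.1) (opZ bV.1).
  by rewrite newton_schulz_lim_support.
- move=> S c c2 bS ST ST'; apply: newton_schulz_lim_scomm => // v.
    by rewrite /scl (opZ bS.1) ST !scalerA mulrC.
  by rewrite /scl (opZ bS.1) ST' !scalerA mulrC.
- move=> S bS ST; apply: newton_schulz_lim_annihilated => // v.
  by rewrite /scl (opZ bS.1) ST scaler0.
Qed.

End PolarPart.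

(** * Commutants and generated von Neumann algebras *)

Section VonNeumannAlgebras.
Variables (R : realType) (H : hilbertSpace R).
Local Notation C := R[i].
Local Notation "'[ x , y ]" := (inner H x y).
Implicit Types (u v w : H) (S T : H -> H) (V W : set (H -> H)).

Lemma bounded_id : bounded_operator (idfun : H -> H).
Proof.
by apply/bounded_operatorP; split=> //; exists 1 => // v; rewrite mul1r.
Qed.

Lemma bounded_comp S T :
  bounded_operator S -> bounded_operator T -> bounded_operator (S \o T).
Proof.
move=> [lS cS] [lT cT]; split; first by move=> k u v /=; rewrite lT lS.
by move=> v; apply: continuous_comp; [exact: cT|exact: cS].
Qed.

Lemma bounded_lin (k : C) S T :
  bounded_operator S -> bounded_operator T -> bounded_operator (k *: S + T).
Proof.
move=> [lS cS] [lT cT]; split.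
  move=> a u v; rewrite !fctE lS lT !scalerDr !scalerA mulrC.
  by rewrite addrACA.
move=> v; apply: cvgD; last exact: cT.
by apply: cvgZl_tmp; exact: cS.
Qed.

Lemma bounded0 : bounded_operator (0 : H -> H).
Proof.
by rewrite -(addNr idfun) -scaleN1r; apply: bounded_lin; exact: bounded_id.
Qed.

Lemma bounded_add S T :
  bounded_operator S -> bounded_operator T -> bounded_operator (S + T).
Proof. by rewrite -{2}[S]scale1r; exact: bounded_lin. Qed.

Lemma bounded_scale k S : bounded_operator S -> bounded_operator (k *: S).
Proof. by move=> bS; rewrite -[_ *: _]addr0; apply: bounded_lin bS bounded0. Qed.

Lemma adjoint_bounded T : bounded_operator T -> bounded_operator (adjoint T).
Proof. by move=> /adjointP[]. Qed.

Lemma inner_adjoint T : bounded_operator T ->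
  forall v w, '[T v, w] = '[v, adjoint T w].
Proof. by move=> /adjointP[]. Qed.

Lemma inner_adjointl T : bounded_operator T ->
  forall v w, '[adjoint T v, w] = '[v, T w].
Proof. by move=> bT v w; rewrite inner_conj -inner_adjoint// -inner_conj. Qed.

Lemma adjointK T : bounded_operator T -> adjoint (adjoint T) = T.
Proof.
by move=> bT; apply: adjoint_unique (inner_adjointl bT); exact: adjoint_bounded.
Qed.

Lemma adjoint_comp S T : bounded_operator S -> bounded_operator T ->
  adjoint (S \o T) = adjoint T \o adjoint S.
Proof.
move=> bS bT; apply: adjoint_unique; first exact: bounded_comp.
by move=> v w /=; rewrite !inner_adjoint.
Qed.

Lemma adjoint_id : adjoint (idfun : H -> H) = idfun.
Proof. exact: adjoint_unique bounded_id _. Qed.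

Lemma commutantP V T : commutant V T <->
  bounded_operator T /\ forall S, V S -> forall v, S (T v) = T (S v).
Proof.
split=> -[bT h]; split=> // S VS; last by apply/funext => v /=; exact: h.
by move=> v; have /(congr1 (@^~ v)) := h _ VS.
Qed.

Lemma commutant_bounded V : commutant V `<=` @bounded_operator R H.
Proof. by move=> T []. Qed.

Lemma commutantS V W : V `<=` W -> commutant W `<=` commutant V.
Proof. by move=> VW T [bT h]; split=> // S /VW; exact: h. Qed.

Lemma sub_bicommutant V :
  V `<=` @bounded_operator R H -> V `<=` commutant (commutant V).
Proof. by move=> bV T VT; split=> [|S [_ h]]; [exact: bV|rewrite h]. Qed.

Lemma commutant_comp V S T :
  commutant V S -> commutant V T -> commutant V (S \o T).
Proof.
move=> /commutantP[bS hS] /commutantP[bT hT]; apply/commutantP.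
by split=> [|U VU v /=]; [exact: bounded_comp|rewrite hS// hT].
Qed.

Lemma commutant_lin V (k : C) S T : V `<=` @bounded_operator R H ->
  commutant V S -> commutant V T -> commutant V (k *: S + T).
Proof.
move=> bV /commutantP[bS hS] /commutantP[bT hT]; apply/commutantP.
by split=> [|U VU v]; [exact: bounded_lin|rewrite !fctE (bV U VU).1 hS// hT].
Qed.

Lemma commutant_add V S T : V `<=` @bounded_operator R H ->
  commutant V S -> commutant V T -> commutant V (S + T).
Proof. by move=> bV VS VT; rewrite -[S]scale1r; exact: commutant_lin. Qed.

Lemma commutant_id V : V `<=` @bounded_operator R H -> commutant V idfun.
Proof. by move=> bV; apply/commutantP; split=> //; exact: bounded_id. Qed.

Lemma commutant_scale V (k : C) S : V `<=` @bounded_operator R H ->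
  commutant V S -> commutant V (k *: S).
Proof.
move=> bV /commutantP[bS hS]; apply/commutantP.
by split=> [|U VU v]; [exact: bounded_scale|rewrite !fctE (opZ (bV U VU).1) hS].
Qed.

Lemma commutant_sub V S T : V `<=` @bounded_operator R H ->
  commutant V S -> commutant V T -> commutant V (S - T).
Proof.
move=> bV VS VT; rewrite -scaleN1r.
by apply: commutant_add => //; exact: commutant_scale.
Qed.

Lemma commutant_adjoint V T : V `<=` @bounded_operator R H ->
  (forall S, V S -> V (adjoint S)) -> commutant V T -> commutant V (adjoint T).
Proof.
move=> bV aV /commutantP[bT hT]; apply/commutantP.
split=> [|S VS v]; first exact: adjoint_bounded.
apply: inner_extr => w; have bS := bV S VS.
rewrite -(inner_adjointl bS) -(inner_adjoint bT) -(inner_adjoint bT).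
by rewrite -(inner_adjointl bS) hT//; exact: aV.
Qed.

Lemma commutant_von_neumann V : V `<=` @bounded_operator R H ->
  (forall S, V S -> V (adjoint S)) -> von_neumann_algebra (commutant V).
Proof.
move=> bV aV; split; first exact: commutant_bounded.
  by move=> T; exact: commutant_adjoint.
apply/seteqP; split; first by apply: commutantS; exact: sub_bicommutant.
by apply: sub_bicommutant; exact: commutant_bounded.
Qed.

(** A von Neumann algebra W containing V satisfies V'' <= W'' = W. With V arbitrary, this covers the
    family of products u_ij u_kl, which is not visibly closed under adjoints. *)
Lemma bicommutant_sub_generated V :
  commutant (commutant V) `<=` von_neumann_generated V.
Proof.
move=> T hT W [[_ _ eW] VW]; rewrite -eW.
exact: (commutantS (commutantS VW) hT).
Qed.

Lemma von_neumann_generatedE V : V `<=` @bounded_operator R H ->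
  (forall S, V S -> V (adjoint S)) ->
  von_neumann_generated V = commutant (commutant V).
Proof.
move=> bV aV; apply/seteqP; split; last exact: bicommutant_sub_generated.
apply: smallest_sub; last exact: sub_bicommutant.
apply: commutant_von_neumann; first exact: commutant_bounded.
by move=> T; exact: commutant_adjoint.
Qed.

(** Each element of [V] commutes with [T] and [adjoint T], so the case c = 1 of the invariance in
    [polar_part] puts the partial isometry in the same commutant. *)
Lemma commutant_polar V T : V `<=` @bounded_operator R H ->
  (forall S, V S -> V (adjoint S)) -> commutant V T ->
  exists S, [/\ commutant V S, S \o adjoint S \o S = S, S \o adjoint S \o T = T,
   forall (U : H -> H) (c : C), c ^+ 2 = 1 -> bounded_operator U ->
    (forall v, U (T v) = c *: T (U v)) ->
    (forall v, U (adjoint T v) = c *: adjoint T (U v)) ->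
    forall v, U (S v) = c *: S (U v) &
   forall U, bounded_operator U -> (forall v, U (T v) = 0) ->
    forall v, U (S v) = 0].
Proof.
move=> bV aV cT; have /commutantP[bT hT] := cT.
have /commutantP[bT' hT'] := commutant_adjoint bV aV cT.
have [S [bS h1 h2 h3 h4]] := polar_part bT.
exists S; split=> //; apply/commutantP; split=> // U VU v.
rewrite -[RHS]scale1r; apply: h3 => [||w|w]; rewrite ?expr1n ?scale1r//.
- exact: bV.
- exact: hT.
- exact: hT'.
Qed.

End VonNeumannAlgebras.

(** * The conditional expectation onto the operators commuting with the symmetry *)

Section Expectation.
Variables (R : realType) (H : hilbertSpace R).
Local Notation C := R[i].
Local Notation "'[ x , y ]" := (inner H x y).
Implicit Types (u v w : H) (S T x y z : H -> H).

(** Expanding the form at v + w and at v + i w gives two equations for <T v, w> and <T w, v> with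
    only the zero solution. *)
Lemma polarization T : linear T -> (forall v, '[T v, v] = 0) -> T = 0.
Proof.
move=> lT h; apply/funext => v; apply: inner_ext => w; rewrite inner0l.
have h1 : '[T v, w] + '[T w, v] = 0.
  have := h (v + w); rewrite (opD lT) inner_addl !inner_addr !h.
  by rewrite add0r addr0.
have h2 : - 'i * '[T v, w] + 'i * '[T w, v] = 0.
  have := h (v + 'i *: w).
  rewrite (opD lT) (opZ lT) inner_addl !inner_addr !inner_scalel !inner_scaler.
  by rewrite !h conjCi !mulr0 add0r addr0.
have := congr1 (fun t => 'i * t) h2; rewrite /= mulr0 mulrDr !mulrA mulrN.
rewrite -expr2 sqrCi opprK mul1r mulN1r => h3.
have h4 : '[T v, w] *+ 2 = 0 by rewrite mulr2n -{1}[0]addr0 -{1}h1 -h3; ring.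
by apply/eqP; move/eqP: h4; rewrite mulrn_eq0.
Qed.

Variables (V : set (H -> H)) (W : H -> H).
Hypotheses (bV : V `<=` @bounded_operator R H)
  (bW : bounded_operator W) (WK : forall v, W (W v) = v)
  (selfW : forall v w, '[W v, w] = '[v, W w])
  (WVW : forall S, V S -> V (W \o S \o W)).
Local Notation M := (commutant V).
Local Notation N := (M `&` [set T | forall v, W (T v) = T (W v)]).

Definition even_part x : H -> H := (2^-1 : C) *: (x + (W \o x \o W)).
Local Notation E := even_part.

Let evenE x v : E x v = 2^-1 *: (x v + W (x (W v))).
Proof. by []. Qed.

Lemma commutant_conj x : M x -> M (W \o x \o W).
Proof.
move=> /commutantP[bx hx]; apply/commutantP; split.
  by apply: bounded_comp => //; exact: bounded_comp.
move=> S VS v /=; have := hx _ (WVW VS) (W v).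
by rewrite /= WK => <-; rewrite WK.
Qed.

Lemma even_part_in x : M x -> N (E x).
Proof.
move=> Mx; split=> [|v].
  apply: commutant_scale => //; apply: commutant_add => //.
  exact: commutant_conj.
by rewrite !evenE (opZ bW.1) (opD bW.1) !WK addrC.
Qed.

Let form_conj x v : '[W (x (W v)), v] = '[x (W v), W v].
Proof. exact: selfW. Qed.

Lemma even_part_form x v : '[E x v, v] = 2^-1 * ('[x v, v] + '[x (W v), W v]).
Proof. by rewrite evenE inner_scalel inner_addl form_conj. Qed.

Let half_ge0 (a : C) : 0 <= a -> 0 <= 2^-1 * a.
Proof. by move=> a0; rewrite mulr_ge0// invr_ge0. Qed.

Lemma even_part_conditional_expectation : conditional_expectation M N E.
Proof.
split.
- exact: even_part_in.
- move=> k x y Mx My; apply/funext => v; rewrite evenE !fctE !evenE.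
  rewrite (opD bW.1) (opZ bW.1) addrACA -(scalerDr k) (scalerDr 2^-1 (k *: _)).
  by rewrite !scalerA mulrC.
- by move=> x Mx hx v; rewrite even_part_form half_ge0// addr_ge0.
- move=> x [Mx hx]; apply/funext => v; rewrite evenE hx WK.
  have -> : x v + x v = (2 : C) *: x v by rewrite scaler_nat.
  by rewrite scalerA mulVf ?scale1r// pnatr_eq0.
- move=> a b x [/commutantP[ba _] ha] [_ hb] Mx; apply/funext => v /=.
  by rewrite !evenE /= hb (opZ ba.1) (opD ba.1) ha.
Qed.

Lemma even_part_faithful : faithful_on M E.
Proof.
move=> x /commutantP[bx _] px Ex; apply: (polarization bx.1) => v.
have : '[E x v, v] = 0 by rewrite Ex; exact: inner0l.
rewrite even_part_form => /eqP.
rewrite mulf_eq0 invr_eq0 pnatr_eq0/= paddr_eq0 ?px//.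
by case/andP => /eqP.
Qed.

(** Order alone suffices, with the supremum used twice. Let z in N bound E(D). Directedness gives y
    + W y' W <= 2 z for y, y' in D. Taking the supremum over y gives x + W y' W <= 2 z; conjugating
    by W, which fixes z, and taking the supremum over y' gives x + W x W <= 2 z. *)
Lemma even_part_normal : normal_on M N E.
Proof.
move=> D x DM [_ _ Ddir] [Mx ubx lubx].
have Mbounded T : M T -> linear T by move=> /commutantP[[]].
have Ele y z : operator_le y z -> operator_le (E y) (E z).
  move=> yz v; have h1 := yz v; have h2 := yz (W v).
  rewrite !fctE !inner_subl in h1 h2 *.
  rewrite !even_part_form -mulrBr half_ge0//.
  by rewrite opprD addrACA addr_ge0.
split; first exact: even_part_in.
  by move=> _ [y Dy <-]; apply: Ele; exact: ubx.
move=> z [Mz Wz] ubz.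
pose z2 := 2 *: z.
have Mz2 : M z2 by exact: commutant_scale.
have Wz2 v : '[z2 (W v), W v] = '[z2 v, v].
  by rewrite -selfW /z2 !fctE (opZ bW.1) Wz WK.
have bound y y' : D y -> D y' -> operator_le y (z2 - (W \o y' \o W)).
  move=> Dy Dy'; have [y2 [Dy2 yy2 y'y2]] := Ddir y y' Dy Dy'.
  move=> v; have := ubz _ (imageP E Dy2) v; have := yy2 v; have := y'y2 (W v).
  rewrite !fctE /= !inner_subl form_conj even_part_form inner_scalel => h1 h2 h3.
  have h4 : 0 <= 2 * ('[z v, v] - 2^-1 * ('[y2 v, v] + '[y2 (W v), W v])).
    by rewrite mulr_ge0.
  have := addr_ge0 (addr_ge0 h1 h2) h4.
  rewrite mulrBr mulrA mulfV ?pnatr_eq0// mul1r.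
  by congr (0 <= _); ring.
have bound' y' : D y' -> operator_le y' (W \o (z2 - x) \o W).
  move=> Dy' v.
  have Mz2y' : M (z2 - (W \o y' \o W)).
    by apply: commutant_sub => //; apply: commutant_conj; exact: DM.
  have := lubx _ Mz2y' (fun y Dy => bound y y' Dy Dy') (W v).
  rewrite !fctE /= !inner_subl !selfW !WK !inner_subl.
  by congr (0 <= _); ring.
have Mz2x : M (W \o (z2 - x) \o W) by apply: commutant_conj; exact: commutant_sub.
move=> v; have := lubx _ Mz2x bound' (W v).
rewrite !fctE /= !inner_subl !selfW !WK !inner_subl.
rewrite even_part_form inner_scalel => h.
have := half_ge0 h.
by rewrite !mulrBr mulrA mulVf ?pnatr_eq0// mul1r mulrDr opprD addrA.
Qed.

Lemma even_part_state_preserving xi : W xi = xi ->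
  state_preserving_expectation M N (vector_state xi) E.
Proof.
move=> Wxi; split.
- exact: even_part_conditional_expectation.
- exact: even_part_faithful.
- exact: even_part_normal.
- move=> x Mx; rewrite /vector_state even_part_form Wxi.
  by field.
Qed.

End Expectation.

(** * Odd operators: commutants and Gram-Schmidt *)

Section OddOperators.
Variables (R : realType) (H : hilbertSpace R).
Local Notation C := R[i].
Local Notation "'[ x , y ]" := (inner H x y).
Implicit Types (u v w : H) (S T x y z : H -> H).
Variable W : H -> H.
Hypotheses (bW : bounded_operator W) (WK : forall v, W (W v) = v)
  (selfW : forall v w, '[W v, w] = '[v, W w]).

Definition odd_operator T := forall v, W (T v) = - T (W v).

Lemma odd_adjoint T :
  bounded_operator T -> odd_operator T -> odd_operator (adjoint T).
Proof.
move=> bT oT v; apply: inner_extr => w.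
rewrite -selfW -(inner_adjoint bT) inner_oppr -(inner_adjoint bT) -selfW.
by rewrite oT inner_oppl opprK.
Qed.

(* [S := \sum_k r_k T r_k^*] satisfies [a S = T a] and [S a = a T] for odd [a],
   so [T + S] and [W (T - S)] commute with [O]. *)
Lemma even_commutant (O : set (H -> H)) n (r : 'I_n -> H -> H) T x :
  O `<=` @bounded_operator R H ->
  (forall a, O a -> odd_operator a) ->
  (forall k, O (r k)) -> (forall k, O (adjoint (r k))) ->
  (forall v, \sum_k r k (adjoint (r k) v) = v) ->
  bounded_operator T ->
  (forall a b, O a -> O b -> forall v, a (b (T v)) = T (a (b v))) ->
  commutant (commutant O) x -> (forall v, W (x v) = x (W v)) ->
  forall v, x (T v) = T (x v).
Proof.
move=> bO oO Or Or' r1 bT hT /commutantP[bx hx] Wx.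
pose S : H -> H := \sum_k (r k \o T \o adjoint (r k)).
have SE v : S v = \sum_k r k (T (adjoint (r k) v)).
  by rewrite /S fct_sumE.
have bS : bounded_operator S.
  rewrite /S; elim/big_ind: _ => [|? ? ? ?|k _]; first exact: bounded0.
    exact: bounded_add.
  apply: bounded_comp; last exact: (bO _ (Or' k)).
  by apply: bounded_comp => //; exact: (bO _ (Or k)).
(* [T] moves past the product of the two odd operators r_k^* and [a], after which the sum of the r_k
   r_k^* collapses to the identity. *)
have Sa a v : O a -> S (a v) = a (T v).
  move=> Oa; rewrite SE -[RHS]r1; apply: eq_bigr => k _.
  by rewrite -hT.
have aS a v : O a -> a (S v) = T (a v).
  move=> Oa; rewrite SE (op_sum (bO _ Oa).1) -{2}[v]r1.
  rewrite (op_sum (bO _ Oa).1) (op_sum bT.1).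
  by apply: eq_bigr => k _; rewrite hT.
have bTS := bounded_add bT bS.
have bTS' : bounded_operator (T - S).
  by rewrite -scaleN1r; apply: bounded_add => //; exact: bounded_scale.
have c1 : commutant O (T + S).
  apply/commutantP; split=> // a Oa v.
  by rewrite !fctE (opD (bO _ Oa).1) Sa// aS// addrC.
have c2 : commutant O (W \o (T - S)).
  apply/commutantP; split=> [|a Oa v /=]; first exact: bounded_comp.
  rewrite !fctE -[a (W _)]opprK -(oO _ Oa) (opB (bO _ Oa).1) Sa// aS//.
  by rewrite -(opN bW.1) opprB.
have TE v : T v = (2^-1 : C) *: ((T + S) v + W ((W \o (T - S)) v)).
  rewrite /= WK !fctE addrACA subrr addr0.
  have -> : T v + T v = (2 : C) *: T v by rewrite scaler_nat.
  by rewrite scalerA mulVf ?scale1r// pnatr_eq0.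
move=> v; rewrite [in LHS]TE (opZ bx.1) (opD bx.1) -hx// -Wx -hx//.
Qed.
(** The operator Q = sum m_j m_j^* projects onto the ranges already covered. The polar part S of T =
    r_n - Q r_n plays the role of the normalized remainder and may be zero. As S S^* T = T and S^* Q
    = 0, adding S S^* to Q reproduces r_n and leaves the earlier r_k unchanged. *)
Lemma odd_gram_schmidt (V : set (H -> H)) (r : nat -> H -> H) n :
  V `<=` @bounded_operator R H -> (forall S, V S -> V (adjoint S)) ->
  (forall k, commutant V (r k)) -> (forall k, odd_operator (r k)) ->
  exists m : nat -> H -> H, [/\
    forall k, (k < n)%N -> commutant V (m k) /\ odd_operator (m k),
    forall k, (k < n)%N -> m k \o adjoint (m k) \o m k = m k,
    forall j k, (j < k < n)%N -> forall v, adjoint (m j) (m k v) = 0 &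
    forall k, (k < n)%N -> forall v,
      \sum_(j < n) m j (adjoint (m j) (r k v)) = r k v].
Proof.
move=> bV aV Vr or; elim: n => [|n [m [m1 m2 m3 m4]]].
  by exists r; split=> // j k; rewrite ltn0 andbF.
have bm k : (k < n)%N -> bounded_operator (m k) by case/m1 => /commutant_bounded.
have bm' k : (k < n)%N -> bounded_operator (adjoint (m k)).
  by move=> /bm; exact: adjoint_bounded.
pose Q := \sum_(j < n) (m j \o adjoint (m j)).
have QE v : Q v = \sum_(j < n) m j (adjoint (m j) v) by rewrite /Q fct_sumE.
have VQ : commutant V Q.
  rewrite /Q; elim/big_ind: _ => [|? ? ? ?|k _].
  - by rewrite -(subrr idfun); apply: commutant_sub => //; exact: commutant_id.
  - exact: commutant_add.
  - have [? _] := m1 k (ltn_ord k).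
    by apply: commutant_comp => //; exact: commutant_adjoint.
pose T := r n - (Q \o r n).
have VT : commutant V T by apply: commutant_sub => //; exact: commutant_comp.
have bT := commutant_bounded VT.
have m'm j k v : (j < n)%N -> (k < n)%N -> j != k -> adjoint (m j) (m k v) = 0.
  move=> jn kn; case: ltngtP => // jk _; first by apply: m3; rewrite jk.
  apply: inner_ext => w; rewrite (inner_adjointl (bm _ jn)) inner0l.
  by rewrite (inner_adjoint (bm _ kn)) m3 ?jk// inner0r.
have m'mm j v : (j < n)%N ->
    adjoint (m j) (m j (adjoint (m j) v)) = adjoint (m j) v.
  move=> jn; apply: inner_ext => w; rewrite (inner_adjointl (bm _ jn)).
  rewrite (inner_adjoint (bm _ jn)) !(inner_adjointl (bm _ jn)).
  by have /(congr1 (@^~ w)) /= -> := m2 _ jn.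
have m'T j v : (j < n)%N -> adjoint (m j) (T v) = 0.
  move=> jn; rewrite /T !fctE (opB (bm' _ jn).1) /= QE (op_sum (bm' _ jn).1).
  rewrite (bigD1 (Ordinal jn))//= m'mm// big1 ?addr0 ?subrr// => k.
  by rewrite -val_eqE /= eq_sym => kj; rewrite m'm.
have oQ v : W (Q v) = Q (W v).
  rewrite !QE (op_sum bW.1); apply: eq_bigr => k _.
  have [_ ok] := m1 k (ltn_ord k).
  by rewrite ok odd_adjoint// ?(opN (bm _ _).1) ?opprK//; exact: bm.
have oT : odd_operator T.
  move=> v; rewrite /T !fctE /= (opB bW.1) oQ or.
  by rewrite (opN (commutant_bounded VQ).1) opprB addrC opprK.
have [S [VS S1 S2 S3 S4]] := commutant_polar bV aV VT.
have bS := commutant_bounded VS; have bS' := adjoint_bounded bS.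
(* Oddness is anticommutation with [W], the case c = -1 of the invariance of the polar part; [T] is
   odd because Q, a sum of products of two odd operators, is even. *)
have oS : odd_operator S.
  move=> v; rewrite -scaleN1r; apply: S3 => //; first by rewrite sqrrN expr1n.
    by move=> w; rewrite scaleN1r oT.
  by move=> w; rewrite scaleN1r odd_adjoint.
have m'S j v : (j < n)%N -> adjoint (m j) (S v) = 0.
  by move=> jn; apply: S4; [exact: bm'|move=> w; exact: m'T].
have S'm j v : (j < n)%N -> adjoint S (m j v) = 0.
  move=> jn; apply: inner_ext => w; rewrite (inner_adjointl bS) inner0l.
  by rewrite (inner_adjoint (bm _ jn)) m'S// inner0r.
pose m_ k := if k == n then S else m k.
have m_lt k : (k < n)%N -> m_ k = m k by rewrite /m_ => /ltn_eqF ->.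
have m_n : m_ n = S by rewrite /m_ eqxx.
exists m_; split.
- move=> k; rewrite ltnS leq_eqVlt => /predU1P[->|kn]; first by rewrite m_n.
  by rewrite m_lt//; exact: m1.
- move=> k; rewrite ltnS leq_eqVlt => /predU1P[->|kn]; first by rewrite m_n.
  by rewrite m_lt//; exact: m2.
- move=> j k /andP[jk]; rewrite ltnS leq_eqVlt => /predU1P[kn|kn] v.
    by rewrite kn m_n m_lt -?kn// m'S// -kn.
  by rewrite !m_lt ?(ltn_trans jk)// m3// jk.
- have sumE v : \sum_(j < n.+1) m_ j (adjoint (m_ j) v) = Q v + S (adjoint S v).
    rewrite big_ord_recr /= m_n QE; congr (_ + _); apply: eq_bigr => j _.
    by rewrite m_lt.
  move=> k; rewrite ltnS leq_eqVlt => /predU1P[->|kn] v; rewrite sumE.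
    have rE : r n v = T v + Q (r n v) by rewrite /T !fctE /= subrK.
    have S'Q w : adjoint S (Q w) = 0.
      by rewrite QE (op_sum bS'.1) big1// => j _; rewrite S'm.
    rewrite {2}rE (opD bS'.1) S'Q addr0.
    by have /(congr1 (@^~ v)) /= -> := S2; rewrite addrC -rE.
  rewrite QE m4// -[X in adjoint S X](m4 _ kn) (op_sum bS'.1).
  rewrite big1 ?(op0 bS.1) ?addr0//.
  by move=> j _; rewrite S'm.
Qed.

End OddOperators.

(** * The orthonormal basis built from an odd frame *)

Section OrthonormalBasis.
Variables (R : realType) (H : hilbertSpace R).
Local Notation C := R[i].
Local Notation "'[ x , y ]" := (inner H x y).
Implicit Types (u v w : H) (S T x y z : H -> H).

(** The identity is orthogonal to every m_k because the expectation kills odd operators, while m_j^*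
    m_k is even and therefore fixed by it. *)
Lemma orthonormal_basis_odd_frame (V : set (H -> H)) (W : H -> H)
    (r : nat -> H -> H) n xi :
  V `<=` @bounded_operator R H -> (forall S, V S -> V (adjoint S)) ->
  bounded_operator W -> (forall v, W (W v) = v) ->
  (forall v w, '[W v, w] = '[v, W w]) ->
  (forall S, V S -> V (W \o S \o W)) ->
  (forall k, commutant V (r k)) -> (forall k, odd_operator W (r k)) ->
  (forall v, \sum_(k < n) r k (adjoint (r k) v) = v) ->
  closure [set x xi | x in commutant V] = [set: H] ->
  exists m : 'I_n.+1 -> H -> H, orthonormal_basis (commutant V)
    (commutant V `&` [set T | forall v, W (T v) = T (W v)]) xi (even_part W) m.
Proof.
move=> bV aV bW WK selfW WVW Vr or r1 cyc.
set M := commutant V; set N := M `&` _; set E := even_part W.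
have [m [m1 m2 m3 m4]] := odd_gram_schmidt bW selfW n bV aV Vr or.
have [_ _ _ EN _] := even_part_conditional_expectation bV bW WK selfW WVW.
have EM x : M x -> N (E x) by exact: even_part_in.
have Eodd x : odd_operator W x -> E x = 0.
  move=> ox; apply/funext => v.
  by rewrite /E /even_part !fctE /= ox WK subrr scaler0.
have mM (k : 'I_n) : M (m k) by case: (m1 k (ltn_ord k)).
have mo (k : 'I_n) : odd_operator W (m k) by case: (m1 k (ltn_ord k)).
have mb (k : 'I_n) := commutant_bounded (mM k).
have mM' (k : 'I_n) : M (adjoint (m k)).
  exact: (commutant_adjoint bV aV (mM k)).
have mo' (k : 'I_n) : odd_operator W (adjoint (m k)).
  exact: (odd_adjoint selfW (mb k) (mo k)).
have mb' (k : 'I_n) := commutant_bounded (mM' k).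
have MI : M idfun := commutant_id bV.
have m'm (j k : 'I_n) : j != k -> adjoint (m j) \o m k = 0.
  rewrite -val_eqE; case: ltngtP => // jk _; apply/funext => v /=.
    by rewrite m3// jk /=.
  apply: inner_ext => w; rewrite inner_adjointl// inner0l inner_adjoint//.
  by rewrite m3 ?jk ?inner0r//=.
(* The sum of the m_k m_k^* acts as the identity on the range of each r_l, and v = sum r_l r_l^* v
   lies in the span of these ranges. *)
have m_sum v : \sum_(k < n) m k (adjoint (m k) v) = v.
  rewrite -[RHS]r1 -[in LHS](r1 v).
  under eq_bigr => k _ do rewrite (op_sum (mb' k).1) (op_sum (mb k).1).
  by rewrite exchange_big /=; apply: eq_bigr => k _; rewrite m4.
have even_comp x y : odd_operator W x -> odd_operator W y -> linear x ->
    forall v, W ((x \o y) v) = (x \o y) (W v).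
  by move=> ox oy lx v /=; rewrite ox oy (opN lx) opprK.
pose b (i : 'I_n.+1) : H -> H := if unlift ord0 i is Some k then m k else idfun.
have b0 : b ord0 = idfun by rewrite /b unlift_none.
have bS k : b (lift ord0 k) = m k by rewrite /b liftK.
have NI : N idfun by split.
exists b; split.
- move=> i; case: (unliftP ord0 i) => [k|] ->; first by rewrite bS.
  by rewrite b0.
- exists (fun i => adjoint (b i) \o b i).
    move=> i; case: (unliftP ord0 i) => [k|] ->; last first.
      rewrite b0 adjoint_id; split=> //; split=> //; first exact: bounded_id.
      exact: adjoint_id.
    rewrite bS; split.
      split; first exact: (commutant_comp (mM' k) (mM k)).
      exact: (even_comp _ _ (mo' k) (mo k) (mb' k).1).
    split; first exact: (bounded_comp (mb' k) (mb k)).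
      by apply/funext => v /=; have /(congr1 (@^~ v)) /= -> := m2 _ (ltn_ord k).
    by rewrite (adjoint_comp (mb' k) (mb k)) (adjointK (mb k)).
  move=> i j; case: (unliftP ord0 i) => [k|] ->;
    case: (unliftP ord0 j) => [l|] ->.
  + rewrite !bS (inj_eq lift_inj); case: eqP => [->|/eqP kl].
      apply: EN; split; first exact: (commutant_comp (mM' l) (mM l)).
      exact: (even_comp _ _ (mo' l) (mo l) (mb' l).1).
    by rewrite m'm//; apply: Eodd => v; rewrite (op0 bW.1) oppr0.
  + by rewrite eq_sym eq_liftF bS b0; exact: (Eodd _ (mo' k)).
  + by rewrite eq_liftF bS b0 adjoint_id; exact: (Eodd _ (mo l)).
  + by rewrite eqxx b0 adjoint_id; exact: (EN _ NI).
- apply/seteqP; split=> // v _.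
  have : closure [set x xi | x in M] v by rewrite cyc.
  apply: closureS => _ [x Mx <-].
  (* The odd part of [x]. The basis expansion of [x] is then exact, with coefficient [E x] on the
     identity and m_k^* y on m_k; the closure only serves to pass from M xi to H. *)
  pose y := x - E x.
  have My : M y by apply: commutant_sub => //; case: (EM _ Mx).
  have oy : odd_operator W y.
    move=> w; rewrite /y !fctE (opB bW.1) (EM _ Mx).2 opprB.
    have e : E x (W w) + E x (W w) = x (W w) + W (x w).
      rewrite /E /even_part !fctE /= WK -scalerDl.
      by rewrite (_ : 2^-1 + 2^-1 = 1 :> C) ?scale1r//; field.
    by apply/eqP; rewrite subr_eq addrAC e addrAC subrr add0r.
  exists n.+1, id.
  exists (fun i => if unlift ord0 i is Some k then adjoint (m k) \o y else E x).
  split.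
    move=> i; case: unliftP => [k|] _; last exact: EM.
    split; first exact: (commutant_comp (mM' k) My).
    exact: (even_comp _ _ (mo' k) oy (mb' k).1).
  rewrite big_ord_recl b0 unlift_none /=.
  under eq_bigr => k _ do rewrite bS liftK /=.
  by rewrite m_sum /y addrC -[(x - _) xi]/(x xi - E x xi) subrK.
Qed.

End OrthonormalBasis.

(** * Star subalgebras and induction over generators *)

Section StarSubalgebra.
Variables (C : numClosedFieldType) (A : starAlgType C).

(** The closure properties are bundled so that the subset can be turned into a [starAlgType], a
    legitimate target for the universal property. *)
Record star_subalgebra := StarSubalgebra {
  subalgebra_mem : A -> Prop;
  subalgebra1 : subalgebra_mem 1;
  subalgebra_lin : forall (k : C) a b,
    subalgebra_mem a -> subalgebra_mem b -> subalgebra_mem (k *: a + b);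
  subalgebra_mul : forall a b,
    subalgebra_mem a -> subalgebra_mem b -> subalgebra_mem (a * b);
  subalgebra_star : forall a, subalgebra_mem a -> subalgebra_mem (star a)
}.

Definition subalgebra_pred (S : star_subalgebra) : {pred A} :=
  fun a => `[< subalgebra_mem S a >].

Fact subalgebra_closed S : GRing.subalg_closed (subalgebra_pred S).
Proof.
split; first exact/asboolP/subalgebra1.
  by move=> k a b /asboolP Sa /asboolP Sb; exact/asboolP/subalgebra_lin.
by move=> a b /asboolP Sa /asboolP Sb; exact/asboolP/subalgebra_mul.
Qed.

HB.instance Definition _ S :=
  GRing.isSubalgClosed.Build C A (subalgebra_pred S) (subalgebra_closed S).

Record subalgebra_type (S : star_subalgebra) := SubalgebraElement {
  subalgebra_val : A; _ : subalgebra_val \in subalgebra_pred S }.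

HB.instance Definition _ S := [isSub for @subalgebra_val S].
HB.instance Definition _ S := [Choice of subalgebra_type S by <:].
HB.instance Definition _ S := [SubChoice_isSubAlgebra of subalgebra_type S by <:].

Section Star.
Variable S : star_subalgebra.
Local Notation B := (subalgebra_type S).

Definition sub_star (b : B) : B := SubalgebraElement
  (asboolT (subalgebra_star (asboolW (valP b)))).

Let sub_starK : involutive sub_star.
Proof. by move=> b; apply: val_inj; exact: starK. Qed.
Let sub_starD : {morph sub_star : a b / a + b}.
Proof.
move=> a b; apply: val_inj; rewrite [RHS]raddfD /= -[LHS]/(star (val (a + b))).
by rewrite raddfD starD.
Qed.
Let sub_starM a b : sub_star (a * b) = sub_star b * sub_star a.
Proof.
apply: val_inj; rewrite [RHS]rmorphM /= -[LHS]/(star (val (a * b))).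
by rewrite rmorphM starM.
Qed.
Let sub_starZ k a : sub_star (k *: a) = k^* *: sub_star a.
Proof.
apply: val_inj; rewrite [RHS]linearZ /= -[LHS]/(star (val (k *: a))).
by rewrite linearZ starZ.
Qed.

HB.instance Definition _ :=
  hasStar.Build C B sub_starK sub_starD sub_starM sub_starZ.

Definition sub_incl (b : B) : A := val b.

Fact sub_incl_linear : linear sub_incl.
Proof. exact: linearP. Qed.
Fact sub_incl_monoid : monoid_morphism sub_incl.
Proof. by split; [exact: rmorph1|exact: rmorphM]. Qed.

HB.instance Definition _ :=
  GRing.isLinear.Build C B A *:%R sub_incl sub_incl_linear.
HB.instance Definition _ :=
  GRing.isMonoidMorphism.Build B A sub_incl sub_incl_monoid.

End Star.

(** The universal property gives f from A to the subalgebra. Followed by the inclusion, f agrees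
    with the identity on the generators, hence everywhere, so each a is the image of an element of
    the subalgebra. *)
Lemma free_orthogonal_generated n (F : 'M[C]_n) (U : 'M[A]_n)
    (P : star_subalgebra) : free_orthogonal F U ->
  (forall i j, subalgebra_mem P (U i j)) -> forall a, subalgebra_mem P a.
Proof.
move=> [[[UU1 UU2] UF] ex un] PU a.
pose B : starAlgType C := subalgebra_type P.
pose V : 'M[B]_n := \matrix_(i, j) SubalgebraElement (asboolT (PU i j)).
pose iota : {lrmorphism subalgebra_type P -> A} := @sub_incl P.
have valV : map_mx iota V = U by apply/matrixP => i j; rewrite !mxE.
have val_scal G : map_mx iota (map_mx (in_alg B) G) = map_mx (in_alg A) G.
  apply/matrixP => i j; rewrite !mxE linearZ /=; congr (_ *: _); exact: rmorph1.
have val_star m k (X : 'M[B]_(m, k)) :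
    map_mx iota (map_mx star X) = map_mx star (map_mx iota X).
  by apply/matrixP => i j; rewrite !mxE.
have iota_inj m k (X Y : 'M[B]_(m, k)) : map_mx iota X = map_mx iota Y -> X = Y.
  move=> /matrixP h; apply/matrixP => i j.
  by have := h i j; rewrite !mxE => /val_inj.
(* The relations hold in the subalgebra because the inclusion is injective and respects products,
   stars and scalars. *)
have rV : free_orthogonal_relations F V.
  split.
    split; apply: iota_inj; by rewrite map_mxM map_mx1 val_star -map_trmx valV.
  apply: iota_inj; rewrite !map_mxM val_star !val_scal valV; exact: UF.
have [f sf fU] := ex _ _ rV.
pose g : {lrmorphism A -> A} := iota \o f.
have gid : g =1 (idfun : {lrmorphism A -> A}).
  apply: un => //.
    by move=> b; rewrite /g /= sf.
  rewrite map_mx_comp fU valV; apply/matrixP => i j; by rewrite !mxE.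
rewrite -[a]gid; exact/asboolP/(valP (f a)).
Qed.

End StarSubalgebra.

(** * Maps on the algebraic tensor product *)

Section TensorProduct.
Variables (C : numClosedFieldType) (A B T : starAlgType C).
Variable t : {bilinear A -> B -> T}.
Hypothesis tT : tensor_product t.

Lemma tensor_lift (V : lmodType C) (b : A -> B -> V) :
  (forall y, linear (b ^~ y)) -> (forall x, linear (b x)) ->
  exists f : {linear T -> V}, forall x y, f (t x y) = b x y.
Proof.
move=> b1 b2; have [ex _ _ _ _] := tT.
pose b' := HB.pack_for {bilinear A -> B -> V} b
  (bilinear_isBilinear.Build C A B V *:%R *:%R b (b1, b2)).
exact: (ex _ b').
Qed.

Lemma tensor_ext (V : lmodType C) (f g : T -> V) : linear f -> linear g ->
  (forall x y, f (t x y) = g (t x y)) -> f =1 g.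
Proof.
move=> lf lg; have [_ un _ _ _] := tT.
pose f' := HB.pack_for {linear T -> V} f (GRing.isLinear.Build C T V *:%R f lf).
pose g' := HB.pack_for {linear T -> V} g (GRing.isLinear.Build C T V *:%R g lg).
exact: (un _ f' g').
Qed.

Lemma tensor_morph (f : {linear T -> T}) :
  (forall x x' y y', f (t x y * t x' y') = f (t x y) * f (t x' y')) ->
  forall X Y, f (X * Y) = f X * f Y.
Proof.
move=> h X Y; move: X; apply: tensor_ext => [k X X'|k X X'|x y].
- by rewrite mulrDl -scalerAl linearP.
- by rewrite linearP mulrDl -scalerAl.
move: Y; apply: tensor_ext => [k X X'|k X X'|x' y'].
- by rewrite mulrDr -scalerAr linearP.
- by rewrite linearP mulrDr -scalerAr.
exact: h.
Qed.

Lemma tensor_star (f : {linear T -> T}) :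
  (forall x y, f (star (t x y)) = star (f (t x y))) ->
  forall X, f (star X) = star (f X).
Proof.
(* Both sides were conjugate-linear in [X]; after moving one star across they are linear, as
   [tensor_ext] requires. *)
move=> h X; rewrite -[LHS]starK; congr star; move: X.
apply: tensor_ext => [k X X'|k X X'|x y].
- by rewrite starD starZ linearP starD starZ conjCK.
- by rewrite linearP.
by rewrite h starK.
Qed.

End TensorProduct.

(** * The parity automorphism and invariance of the Haar state *)

Section Parity.
Variables (C : numClosedFieldType) (n : nat) (F : 'M[C]_n) (A : starAlgType C).
Variable U : 'M[A]_n.
Hypothesis fU : free_orthogonal F U.

Lemma star_opp (B : starAlgType C) (a : B) : star (- a) = - star a.
Proof. by rewrite -scaleN1r starZ rmorphN1 scaleN1r. Qed.

Lemma star1 (B : starAlgType C) : star 1 = 1 :> B.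
Proof. by rewrite -[LHS]mulr1 -{2}[1]starK -starM mulr1 starK. Qed.

Lemma parity_automorphism : exists alpha : {lrmorphism A -> A},
  [/\ star_morphism alpha, forall i j, alpha (U i j) = - U i j &
      forall a, alpha (alpha a) = a].
Proof.
have [[[UU1 UU2] UF] ex un] := fU.
have rV : free_orthogonal_relations F (- U).
  have starN m k (X : 'M[A]_(m, k)) : map_mx star (- X) = - map_mx star X.
    by apply/matrixP => i j; rewrite !mxE star_opp.
  split; last by rewrite starN mulmxN mulNmx -UF.
  by split; rewrite linearN /= starN mulmxN mulNmx opprK.
have [alpha sa aU] := ex _ _ rV.
have aUE i j : alpha (U i j) = - U i j.
  by have /matrixP/(_ i j) := aU; rewrite !mxE.
exists alpha; split=> //.
pose beta : {lrmorphism A -> A} := alpha \o alpha.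
apply: (un A beta idfun) => //; first by move=> a; rewrite /beta /= !sa.
apply/matrixP => i j; rewrite [LHS]mxE [RHS]mxE -[LHS]/(alpha (alpha (U i j))).
by rewrite aUE rmorphN /= aUE opprK.
Qed.

(** On generators, hence everywhere, Delta alpha = (alpha (x) id) Delta. Applying h (x) h and using
    left invariance on one side and right invariance on the other gives h(alpha(a)) = h(a). *)
Lemma haar_parity (T : starAlgType C) (t : {bilinear A -> A -> T})
    (Delta : {lrmorphism A -> T}) (h : {scalar A}) (alpha : {lrmorphism A -> A}) :
  tensor_product t -> comultiplication U t Delta -> haar_state t Delta h ->
  star_morphism alpha -> (forall i j, alpha (U i j) = - U i j) ->
  forall a, h (alpha a) = h a.
Proof.
move=> tT [sD DU] [[h1 _] hl hr] sa aU a.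
have [f fE] : exists f : {linear T -> T}, forall x y, f (t x y) = t (alpha x) y.
  apply: (tensor_lift tT) => [y k x x'|x k y y'].
    by rewrite linearP linearPl.
  by rewrite linearPr.
have [s1 s1E] : exists s : {linear T -> A}, forall x y, s (t x y) = h x *: y.
  apply: (tensor_lift tT) => [y k x x'|x k y y'].
    by rewrite linearP scalerDl scalerA.
  by rewrite scalerDr !scalerA mulrC.
have [s2 s2E] : exists s : {linear T -> A}, forall x y, s (t x y) = h y *: x.
  apply: (tensor_lift tT) => [y k x x'|x k y y'].
    by rewrite scalerDr !scalerA mulrC.
  by rewrite linearP scalerDl scalerA.
have [_ _ t1 tM ts] := tT.
have fM : forall X Y, f (X * Y) = f X * f Y.
  by apply: (tensor_morph tT) => x x' y y'; rewrite tM !fE rmorphM tM.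
have fS : forall X, f (star X) = star (f X).
  by apply: (tensor_star tT) => x y; rewrite ts !fE sa ts.
have fDelta : forall b, Delta (alpha b) = f (Delta b).
  pose P := @StarSubalgebra C A (fun b => Delta (alpha b) = f (Delta b)).
  have D1 : Delta (alpha 1) = f (Delta 1) by rewrite !rmorph1 -t1 fE rmorph1.
  have Dlin k b c : Delta (alpha b) = f (Delta b) ->
      Delta (alpha c) = f (Delta c) ->
      Delta (alpha (k *: b + c)) = f (Delta (k *: b + c)).
    by move=> hb hc; rewrite !linearP /= hb hc.
  have DM b c : Delta (alpha b) = f (Delta b) ->
      Delta (alpha c) = f (Delta c) -> Delta (alpha (b * c)) = f (Delta (b * c)).
    by move=> hb hc; rewrite !rmorphM /= hb hc fM.
  have DS b : Delta (alpha b) = f (Delta b) ->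
      Delta (alpha (star b)) = f (Delta (star b)).
    by move=> hb; rewrite sa !sD hb fS.
  apply: (free_orthogonal_generated (P := P D1 Dlin DM DS) fU) => i j /=.
  rewrite aU rmorphN /= DU [in RHS]linear_sum -sumrN; apply: eq_bigr => k _.
  by rewrite fE aU linearNl.
(* Both sides equal h(alpha(x)) h(y) on an elementary tensor; at [Delta a] they become h(alpha(a))
   and h(a). *)
have e : forall X, h (s1 (f X)) = h (alpha (s2 X)).
  apply: (tensor_ext tT (V := C^o)) => [k X Y|k X Y|x y].
  - by rewrite !linearP.
  - by rewrite !linearP.
  by rewrite fE s1E s2E !linearZ /= mulrC.
have := e (Delta a); rewrite -fDelta (hl _ s1E) (hr _ s2E).
by rewrite !linearZ /= !rmorph1 h1 !mulr1.
Qed.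
End Parity.

(** * Extension of isometries from a dense subspace *)

Section DenseExtension.
Variables (R : realType) (H : hilbertSpace R).
Local Notation C := R[i].
Local Notation "'[ x , y ]" := (inner H x y).
Implicit Types (u v w : H).

Lemma nrm_scale (k : C) v : nrm (k *: v) = complex.Re `|k| * nrm v.
Proof.
have kE : `|k| = (complex.Re `|k|)%:C by rewrite RRe_real// normr_real.
by rewrite {1}/nrm normrZ nrmE {1}kE -rmorphM.
Qed.

Lemma bounded_dense_eq (A : Type) (d : A -> H) (S T : H -> H) :
  bounded_operator S -> bounded_operator T ->
  closure (range d) = [set: H] -> (forall a, S (d a) = T (d a)) ->
  forall v, S v = T v.
Proof.
move=> bS bT cd e v.
have bST : bounded_operator (S - T).
  by rewrite -scaleN1r; apply: bounded_add => //; exact: bounded_scale.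
have [lX [K K0 hK]] := (bounded_operatorP _).1 bST.
apply/eqP; rewrite -subr_eq0; apply/eqP/nrm_eq0/eqP; rewrite eq_le nrm_ge0 andbT.
apply/ler_addgt0Pr => eps e0; rewrite add0r.
have : closure (range d) v by rewrite cd.
move=> /closure_nrmP /(_ _ (divr_gt0 e0 K0)) [_ [a _ <-]].
rewrite ltr_pdivlMr// mulrC => h; apply: le_trans (ltW h).
rewrite (le_trans _ (hK _))// (opB lX) !fctE e.
by rewrite (_ : T (d a) - T (d a) = 0) ?subrr ?subr0.
Qed.

(** As [d] may fail to be injective, W is read off from the closure of the set of pairs (d a, g a).
    The isometry condition makes this relation both total and single-valued. *)
Lemma isometry_extension (A : lmodType C) (d g : A -> H) :
  linear d -> linear g -> closure (range d) = [set: H] ->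
  (forall a, nrm (g a) = nrm (d a)) ->
  exists W : H -> H, [/\ bounded_operator W, forall v, nrm (W v) <= nrm v &
    forall a, W (d a) = g a].
Proof.
move=> ld lg cd iso.
have subE (f : A -> H) a b : linear f -> f (a - b) = f a - f b.
  by move=> lf; rewrite -scaleN1r addrC lf scaleN1r addrC.
have isoB a b : nrm (g a - g b) = nrm (d a - d b) by rewrite -!subE.
pose graph v w := forall e : R, 0 < e ->
  exists2 a, nrm (v - d a) < e & nrm (w - g a) < e.
have graph_ex v : exists w, graph v w.
  have /choice [a ha] : forall k : nat, exists a, nrm (v - d a) < k.+1%:R^-1.
    move=> k; have : closure (range d) v by rewrite cd.
    move=> /closure_nrmP /(_ k.+1%:R^-1) []; first by rewrite invr_gt0.
    by move=> _ [a _ <-]; exists a.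
  have [w hw] : exists w : H, g (a k) @[k --> \oo] --> w.
    apply: nrm_complete => e e0; have e2 : 0 < e / 2 by rewrite divr_gt0.
    have [N _ hN] := near_infty_natSinv_lt (PosNum e2).
    exists N => m n Nm Nn; rewrite isoB.
    rewrite -(subrK v (d (a m))) -addrA (le_lt_trans (nrm_triangle _ _))//.
    rewrite (splitr e) ltrD//; last exact: lt_trans (ha n) (hN n Nn).
    by rewrite nrm_distC; exact: lt_trans (ha m) (hN m Nm).
  exists w => e e0; have [N1 _ h1] := near_infty_natSinv_lt (PosNum e0).
  have [N2 h2] := (cvg_nrmP _ _).1 hw _ e0.
  exists (a (maxn N1 N2)); first exact: lt_trans (ha _) (h1 _ (leq_maxl _ _)).
  by rewrite nrm_distC h2// leq_maxr.
have graph_fun v w w' : graph v w -> graph v w' -> w = w'.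
  move=> h h'; apply/eqP; rewrite -subr_eq0; apply/eqP/nrm_eq0/eqP.
  rewrite eq_le nrm_ge0 andbT; apply/ler_addgt0Pr => e e0; rewrite add0r.
  (* Four errors add up: from w to g a, from g b to w', and, as g a and g b are as far apart as d a
     and d b, from d a to v and from v to d b. *)
  have e4 : 0 < e / 4 by rewrite divr_gt0.
  have [a a1 a2] := h _ e4; have [b b1 b2] := h' _ e4.
  have h1 := nrm_triangle (w - g a) (g a - w').
  have h2 := nrm_triangle (g a - g b) (g b - w').
  have h3 := nrm_triangle (d a - v) (v - d b).
  rewrite !addrA !subrK in h1 h2 h3.
  rewrite isoB in h2; rewrite (nrm_distC (d a) v) in h3.
  rewrite (nrm_distC (g b) w') in h2.
  move: h1 h2 h3 a1 a2 b1 b2; clear.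
  move: (nrm (w - w')) (nrm (w - g a)) (nrm (g a - w')) (nrm (d a - d b)).
  move: (nrm (w' - g b)) (nrm (v - d a)) (nrm (v - d b)) => x1 x2 x3 x4 x5 x6 x7.
  lra.
have [W hW] := choice graph_ex.
have Wd a : W (d a) = g a.
  by apply: (graph_fun _ _ _ (hW _)) => e e0; exists a; rewrite subrr nrm0.
have lW : linear W.
  move=> k u v; apply: (graph_fun _ _ _ (hW _)) => e e0.
  pose K := complex.Re `|k| + 1.
  have k0 : 0 <= complex.Re `|k|.
    by have := normr_ge0 k; rewrite lecE => /andP[].
  have K0 : 0 < K by rewrite /K ltr_wpDl.
  have eK : 0 < e / 2 / K by rewrite !divr_gt0.
  have e2 : 0 < e / 2 by rewrite divr_gt0.
  have [a a1 a2] := hW u _ eK; have [b b1 b2] := hW v _ e2.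
  have key (x x' y y' : H) : nrm (x - y) < e / 2 / K -> nrm (x' - y') < e / 2 ->
      nrm (k *: x + x' - (k *: y + y')) < e.
    move=> hx hx'; rewrite opprD addrACA -scalerBr.
    rewrite (le_lt_trans (nrm_triangle _ _))// (splitr e) ler_ltD// nrm_scale.
    rewrite ltr_pdivlMr// in hx; rewrite (le_trans _ (ltW hx))// mulrC.
    by rewrite ler_wpM2l ?nrm_ge0// /K lerDl.
  by exists (k *: a + b); rewrite ?ld ?lg key.
suff cW v : nrm (W v) <= nrm v.
  exists W; split=> //; apply/bounded_operatorP; split=> //.
  by exists 1 => // v; rewrite mul1r.
apply/ler_addgt0Pr => e e0.
have e2 : 0 < e / 2 by rewrite divr_gt0.
have [a a1 a2] := hW v _ e2.
have h1 := nrm_triangle (W v - g a) (g a); rewrite subrK iso in h1.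
have h2 := nrm_triangle (d a - v) v; rewrite subrK (nrm_distC (d a)) in h2.
move: h1 h2 a1 a2; clear.
move: (nrm (W v)) (nrm v) (nrm (W v - g a)) (nrm (v - d a)) (nrm (d a)).
move=> x1 x2 x3 x4 x5; lra.
Qed.

End DenseExtension.

(** * Implementation of the parity on the GNS space, and the even subalgebra *)

Section EvenSubalgebra.
Variables (R : realType) (n : nat) (F : 'M[R[i]]_n.+1) (c : R)
    (A : starAlgType R[i]) (U : 'M[A]_n.+1) (h : {scalar A})
    (H : hilbertSpace R) (pi : A -> H -> H) (xi : H)
    (alpha : {lrmorphism A -> A}).
Local Notation C := R[i].
Local Notation "'[ x , y ]" := (inner H x y).
Hypotheses (c0 : c != 0) (FF : F *m map_mx (@Num.conj R[i]) F = (c%:C)%:M)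
  (fU : free_orthogonal F U) (gns : gns_representation h pi xi)
  (salpha : star_morphism alpha) (alphaU : forall i j, alpha (U i j) = - U i j)
  (alphaK : forall a, alpha (alpha a) = a) (halpha : forall a, h (alpha a) = h a).
Implicit Types (a b : A) (u v w : H) (S T : H -> H).

Lemma gns_inner a b : '[pi a xi, pi b xi] = h (star b * a).
Proof.
rewrite -(gns_state gns) (gns_mul gns) (gns_star gns) /=.
by rewrite inner_adjointl//; exact: (gns_bounded gns).
Qed.

Lemma gns_combination k a b v : pi (k *: a + b) v = k *: pi a v + pi b v.
Proof. by rewrite (gns_linear gns). Qed.

(** W sends pi(a) xi to pi(alpha a) xi, an isometry since alpha preserves h. A contraction with W^2
    = 1 is isometric, so W^* W = 1 by polarization, and then W^* = W. *)
Lemma parity_implementation : exists W, [/\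
  bounded_operator W, forall v, W (W v) = v, forall v w, '[W v, w] = '[v, W w],
  W xi = xi & forall a v, W (pi a v) = pi (alpha a) (W v)].
Proof.
have ld : linear (fun a => pi a xi) by move=> k a b; rewrite gns_combination.
have lg : linear (fun a => pi (alpha a) xi).
  by move=> k a b; rewrite linearP gns_combination.
have iso a : nrm (pi (alpha a) xi) = nrm (pi a xi).
  apply: (@pexpIrn _ 2); rewrite ?nnegrE ?nrm_ge0//.
  by rewrite -!rin_nrm /rin !gns_inner -salpha -rmorphM halpha.
have [W [bW cW Wd]] := isometry_extension ld lg (gns_cyclic gns) iso.
have WK v : W (W v) = v.
  apply: (bounded_dense_eq (bounded_comp bW bW) (bounded_id H) (gns_cyclic gns)).
  by move=> a /=; rewrite !Wd alphaK.
have Wn v : nrm (W v) = nrm v.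
  by apply/eqP; rewrite eq_le cW -{1}(WK v) cW.
have W'W v : adjoint W (W v) = v.
  have bW'W := bounded_comp (adjoint_bounded bW) bW.
  have bD : bounded_operator (adjoint W \o W - idfun).
    rewrite -scaleN1r; apply: bounded_add => //; apply: bounded_scale.
    exact: bounded_id.
  apply/eqP; rewrite -subr_eq0; apply/eqP.
  have := polarization bD.1 => /(_ _)/(congr1 (@^~ v)); apply => w.
  rewrite inner_subl inner_adjointl// !inner_nrm Wn; exact: subrr.
have selfW v w : '[W v, w] = '[v, W w].
  by rewrite -{1}(WK w) -(inner_adjointl bW) W'W.
have W1 : W xi = xi.
  by have := Wd 1; rewrite rmorph1 (gns_one gns).
exists W; split=> // a v.
have := bounded_dense_eq (bounded_comp bW (gns_bounded gns a))
  (bounded_comp (gns_bounded gns (alpha a)) bW) (gns_cyclic gns) _ v.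
apply=> b /=; rewrite Wd.
have E d : pi d (pi b xi) = pi (d * b) xi by rewrite (gns_mul gns).
by rewrite E Wd rmorphM (gns_mul gns).
Qed.

(** Solving U = F Ubar F^-1 for Ubar gives Ubar = F^-1 U F, where F is invertible because F Fbar is
    a nonzero scalar. *)
Lemma star_generator i j : exists k : 'I_n.+1 -> 'I_n.+1 -> C,
  star (U i j) = \sum_p \sum_q k p q *: U p q.
Proof.
exists (fun p q => invmx F i p * F q j).
have uF : F \in unitmx.
  have cC : c%:C != 0 by rewrite -(rmorph0 (real_complex R)) fmorph_eq0.
  have [] // := @mulmx1_unit _ _ F ((c%:C)^-1 *: map_mx (@Num.conj R[i]) F).
  by rewrite -scalemxAr FF scale_scalar_mx mulVf.
have [[_ UF] _ _] := fU.
pose scal (G : 'M[C]_n.+1) : 'M[A]_n.+1 := map_mx (in_alg A) G.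
have sFF : scal (invmx F) *m scal F = 1%:M by rewrite -map_mxM mulVmx// map_mx1.
have -> : star (U i j) = (scal (invmx F) *m U *m scal F) i j.
  have -> : scal (invmx F) *m U *m scal F = map_mx star U.
    rewrite {1}UF -/(scal _) -/(scal _) !mulmxA sFF mul1mx -mulmxA sFF.
    by rewrite mulmx1.
  by rewrite mxE.
rewrite !mxE exchange_big /=; apply: eq_bigr => q _.
rewrite !mxE mulr_suml; apply: eq_bigr => p _; rewrite !mxE /=.
by rewrite -scalerAr mulr1 -scalerAl mul1r scalerA mulrC.
Qed.

Definition generators : set A :=
  [set a | exists i j, a = U i j \/ a = star (U i j)].

Lemma generator_commutant :
  commutant (pi @` generators) `<=` commutant (range pi).
Proof.
move=> T /commutantP[bT hT]; apply/commutantP; split=> // _ [a _ <-].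
pose comm b := forall v, pi b (T v) = T (pi b v).
(* Commuting with pi(b) alone is not a condition stable under star, so the predicate includes
   both. *)
pose P := @StarSubalgebra C A (fun b => comm b /\ comm (star b)).
have c1 : comm 1 by move=> v; rewrite (gns_one gns).
have clin k b d : comm b -> comm d -> comm (k *: b + d).
  by move=> hb hd v; rewrite !gns_combination bT.1 hb hd.
have cM b d : comm b -> comm d -> comm (b * d).
  by move=> hb hd v; rewrite !(gns_mul gns) /= hd hb.
have P1 : comm 1 /\ comm (star 1) by rewrite star1.
have Plin k b d : comm b /\ comm (star b) -> comm d /\ comm (star d) ->
    comm (k *: b + d) /\ comm (star (k *: b + d)).
  move=> [b1 b2] [d1 d2]; split; first exact: clin.
  by rewrite starD starZ; exact: clin.
have PM b d : comm b /\ comm (star b) -> comm d /\ comm (star d) ->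
    comm (b * d) /\ comm (star (b * d)).
  move=> [b1 b2] [d1 d2]; split; first exact: cM.
  by rewrite starM; exact: cM.
have PS b : comm b /\ comm (star b) -> comm (star b) /\ comm (star (star b)).
  by move=> [b1 b2]; rewrite starK.
have [] // := free_orthogonal_generated (P := P P1 Plin PM PS) fU _ a.
by move=> i j; split=> v; apply: hT; eexists; [| reflexivity | | reflexivity];
  exists i, j; [left|right].
Qed.

Lemma generator_span b : generators b -> exists k : 'I_n.+1 -> 'I_n.+1 -> C,
  b = \sum_p \sum_q k p q *: U p q.
Proof.
move=> [i [j [->|->]]]; last exact: star_generator.
exists (fun p q => ((p == i) && (q == j))%:R).
rewrite (bigD1 i)//= (bigD1 j)//= !eqxx scale1r !big1 ?addr0// => p.
  move=> /negPf ->; rewrite big1// => q _; exact: scale0r.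
by move=> /negPf ->; rewrite andbF scale0r.
Qed.

Lemma pi_sum I (s : seq I) (P : pred I) (g : I -> A) v :
  pi (\sum_(i <- s | P i) g i) v = \sum_(i <- s | P i) pi (g i) v.
Proof.
have pi0 : pi 0 v = 0.
  by have := gns_combination (-1) 1 1 v; rewrite !scaleN1r !addNr.
have piD a b : pi (a + b) v = pi a v + pi b v.
  by rewrite -{1}[a]scale1r gns_combination scale1r.
by apply: (big_morph (pi^~ v) piD pi0).
Qed.

Lemma pi_scale k a v : pi (k *: a) v = k *: pi a v.
Proof.
have pi0 : pi 0 v = 0.
  by have := gns_combination (-1) 1 1 v; rewrite !scaleN1r !addNr.
by rewrite -[k *: a]addr0 gns_combination pi0 addr0.
Qed.

Lemma range_adjoint S : range pi S -> range pi (adjoint S).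
Proof. by move=> [a _ <-]; exists (star a); rewrite ?(gns_star gns). Qed.

Lemma range_bounded : range pi `<=` @bounded_operator R H.
Proof. by move=> _ [a _ <-]; exact: (gns_bounded gns). Qed.

Lemma LinftyE : Linfty pi = commutant (commutant (range pi)).
Proof.
exact: (von_neumann_generatedE range_bounded range_adjoint).
Qed.

Lemma pi_Linfty a : commutant (commutant (range pi)) (pi a).
Proof. by apply: sub_bicommutant; [exact: range_bounded|exists a]. Qed.

Lemma sum_first_row v :
  \sum_(k < n.+1) pi (U ord0 k) (adjoint (pi (U ord0 k)) v) = v.
Proof.
have [[[/matrixP/(_ ord0 ord0) UU _] _] _ _] := fU.
rewrite !mxE eqxx mulr1n in UU.
transitivity (pi 1 v); last by rewrite (gns_one gns).
rewrite -UU pi_sum; apply: eq_bigr => k _.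
by rewrite !mxE (gns_mul gns) /= (gns_star gns).
Qed.

Variable W : H -> H.
Hypotheses (bW : bounded_operator W) (WK : forall v, W (W v) = v)
  (selfW : forall v w, '[W v, w] = '[v, W w])
  (Wpi : forall a v, W (pi a v) = pi (alpha a) (W v)).

Lemma generators_odd a : generators a -> odd_operator W (pi a).
Proof.
move=> Ga v; rewrite Wpi.
have -> : alpha a = (-1) *: a.
  case: Ga => i [j [->|->]]; first by rewrite alphaU scaleN1r.
  by rewrite salpha alphaU star_opp scaleN1r.
by rewrite pi_scale scaleN1r.
Qed.

(** The right side is a von Neumann algebra, being the commutant of M' together with W, and it
    contains the generators of the left side. Conversely, by [even_commutant] an element of it
    commutes with everything that commutes with the products u_ij u_kl. *)
Lemma even_subalgebraE : even_subalgebra U pi =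
  commutant (commutant (range pi)) `&` [set T | forall v, W (T v) = T (W v)].
Proof.
set M := commutant _.
have bV : commutant (range pi) `<=` @bounded_operator R H.
  exact: commutant_bounded.
apply/seteqP; split.
  apply: smallest_sub.
    pose V := commutant (range pi) `|` [set W].
    have -> : M `&` [set T | forall v, W (T v) = T (W v)] = commutant V.
      apply/seteqP; split=> T.
        move=> [/commutantP[bT hT] WT]; apply/commutantP; split=> // S.
        by case=> [|->//]; exact: hT.
      move=> /commutantP[bT hT]; split; last by apply: hT; right.
      by apply/commutantP; split=> // S VS; apply: hT; left.
    apply: commutant_von_neumann => [S [/bV//|->//]|S [VS|->]].
      left; apply: commutant_adjoint VS; first exact: range_bounded.
      exact: range_adjoint.
    by right; apply: adjoint_unique.
  move=> _ [i [j [k [l ->]]]]; split; first exact: pi_Linfty.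
  by move=> v; rewrite Wpi rmorphM /= !alphaU mulrNN.
move=> x [Mx Wx]; apply: bicommutant_sub_generated.
have /commutantP[bx _] := Mx; apply/commutantP; split=> // T /commutantP[bT hT] v.
apply/esym; move: v.
have Gstar a : generators a -> generators (star a).
  by case=> i [j [->|->]]; exists i, j; rewrite ?starK; [right|left].
have GU k : generators (U ord0 k) by exists ord0, k; left.
apply: (@even_commutant R H W bW WK (pi @` generators) n.+1
  (fun k => pi (U ord0 k)) T x) => //.
- by move=> _ [a _ <-]; exact: (gns_bounded gns).
- by move=> _ [a Ga <-]; exact: generators_odd.
- by move=> k; exists (U ord0 k).
- by move=> k; exists (star (U ord0 k)); [exact: Gstar|exact: (gns_star gns)].
- exact: sum_first_row.
(* By hypothesis [T] commutes with the products u_ij u_kl only; expanding [a] and [b] over the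
   entries of [U] extends this to products involving adjoints. *)
- move=> _ _ [a Ga <-] [b Gb <-] v.
  have [k ->] := generator_span Ga; have [l ->] := generator_span Gb.
  have span2 p q w : pi (U p q) (pi (\sum_p \sum_q l p q *: U p q) (T w)) =
      T (pi (U p q) (pi (\sum_p \sum_q l p q *: U p q) w)).
    have lU := (gns_bounded gns (U p q)).1.
    rewrite !pi_sum !(op_sum lU) (op_sum bT.1); apply: eq_bigr => p' _.
    rewrite !pi_sum !(op_sum lU) (op_sum bT.1); apply: eq_bigr => q' _.
    rewrite !pi_scale !(opZ lU) (opZ bT.1); congr (_ *: _).
    have := hT (pi (U p q * U p' q')).
    rewrite (gns_mul gns) /=; apply; exists p, q, p', q'.
    by rewrite (gns_mul gns).
  move: (\sum_p \sum_q l p q *: U p q) span2 => d span2.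
  rewrite !pi_sum (op_sum bT.1); apply: eq_bigr => p _.
  rewrite !pi_sum (op_sum bT.1); apply: eq_bigr => q _.
  by rewrite !pi_scale (opZ bT.1) span2.
by apply: commutantS Mx; exact: generator_commutant.
Qed.

End EvenSubalgebra.

Theorem proposition9p7 (R : realType) (n : nat) (F : 'M[R[i]]_n) (c : R)
    (A : starAlgType R[i]) (U : 'M[A]_n)
    (T : starAlgType R[i]) (t : {bilinear A -> A -> T})
    (Delta : {lrmorphism A -> T}) (h : {scalar A})
    (H : hilbertSpace R) (pi : A -> H -> H) (xi : H) :
  (2 <= n)%N ->
  c != 0 ->
  F *m map_mx (@Num.conj R[i]) F = (c%:C)%:M ->
  free_orthogonal F U ->
  tensor_product t ->
  comultiplication U t Delta ->
  haar_state t Delta h ->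
  gns_representation h pi xi ->
  let M := Linfty pi in
  let N := even_subalgebra U pi in
  exists E : (H -> H) -> H -> H,
    [/\ state_preserving_expectation M N (vector_state xi) E,
        strongly_finite_index M N xi E &
        exists k (m : 'I_k -> H -> H),
          (k <= n ^ 2 + 1)%N /\ orthonormal_basis M N xi E m].
Proof.
case: n F U => [//|m] F U _ c0 FF fU tT DU haar gns M N.
have [alpha [salpha alphaU alphaK]] := parity_automorphism fU.
have halpha := haar_parity fU tT DU haar salpha alphaU.
have [W [bW WK selfW Wxi Wpi]] := parity_implementation gns salpha alphaK halpha.
have bV : commutant (range pi) `<=` @bounded_operator R H.
  exact: commutant_bounded.
have aV S : commutant (range pi) S -> commutant (range pi) (adjoint S).
  exact: commutant_adjoint (range_bounded gns) (range_adjoint gns).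
have WVW S : commutant (range pi) S -> commutant (range pi) (W \o S \o W).
  move=> /commutantP[bS hS]; apply/commutantP; split.
    by apply: bounded_comp => //; exact: bounded_comp.
  move=> _ [a _ <-] v /=; rewrite -[a]alphaK -Wpi hS; last by exists (alpha a).
  by rewrite alphaK Wpi.
have NE : N = commutant (commutant (range pi)) `&`
    [set T | forall v, W (T v) = T (W v)].
  exact: (even_subalgebraE c0 FF fU gns salpha alphaU bW WK selfW Wpi).
rewrite /M (LinftyE gns) NE.
have [k [b hb]] : exists k (b : 'I_k -> H -> H), (k <= m.+1 ^ 2 + 1)%N /\
    orthonormal_basis (commutant (commutant (range pi)))
      (commutant (commutant (range pi)) `&` [set T | forall v, W (T v) = T (W v)])
      xi (even_part W) b.
  (* The frame is indexed by all naturals; [inord] sends an index beyond the row to 0, which still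
     names an odd generator. With n = [m.+1] the basis has n + 1 elements, within the bound since n
     <= n^2. *)
  have [] := @orthonormal_basis_odd_frame R H (commutant (range pi)) W
    (fun k => pi (U ord0 (inord k))) m.+1 xi => //.
  - by move=> k; apply: pi_Linfty gns _.
  - move=> k; apply: (generators_odd gns salpha alphaU Wpi).
    by exists ord0, (inord k); left.
  - move=> v; rewrite -[RHS](sum_first_row fU gns); apply: eq_bigr => k _.
    by rewrite inord_val.
  - apply/seteqP; split=> // v _.
    have : closure (range (fun a => pi a xi)) v by rewrite (gns_cyclic gns).
    apply: closureS => _ [a _ <-]; exists (pi a) => //; exact: pi_Linfty gns _.
  move=> b hb; exists m.+2, b; split=> //.
  by rewrite addn1 ltnS expnS expn1 leq_pmulr.
exists (even_part W); split.
- exact: even_part_state_preserving.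
- by exists 'I_k, b; case: hb.
- by exists k, b.
Qed.
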